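(* There exist two conic-line arrangements $\mathcal{CL}_1 : Q_1 = 0$ and $\mathcal{CL}_2 : Q_2 = 0$ in $\mathbb{P}^2_{\mathbb{C}}$, both defined over the rational numbers and both having only ordinary quasi-homogeneous singularities, which have the same weak combinatorics $$(d,k;t_2,t_3,t_4) = (6,1;6,3,2)$$ (that is, each consists of $6$ lines and $1$ smooth conic, and has exactly $6$ double, $3$ triple and $2$ quadruple intersection points and no intersection points of higher multiplicity), but which have different minimal degrees of non-trivial Jacobian relations, i.e. $\mathrm{mdr}(Q_1) \neq \mathrm{mdr}(Q_2)$. Furthermore, both $\mathcal{CL}_1$ and $\mathcal{CL}_2$ are nearly free.
   Context: Let $S = \mathbb{C}[x,y,z]$ with the standard grading be the coordinate ring of $\mathbb{P}^2_{\mathbb{C}}$. **Conic-line arrangements.** A conic-line arrangement is a reduced curve in $\mathbb{P}^2_{\mathbb{C}}$ whose irreducible components are $d \geq 1$ pairwise distinct lines and $k \geq 1$ pairwise distinct smooth conics. Its defining polynomial is the product of the defining equations of its components. It is defined over the rational numbers if each of its components is given by an equation with coefficients in $\mathbb{Q}$. **Singularities.** A singular point $p$ of such an arrangement is ordinary if the components passing through $p$ have pairwise distinct tangent lines at $p$. A singular point is quasi-homogeneous if the curve germ at $p$ is given, in suitable local analytic coordinates, by a weighted homogeneous polynomial (with positive weights). **Weak combinatorics.** For a conic-line arrangement with only ordinary singularities, the weak combinatorics is the vector $(d,k;t_2,t_3,\ldots)$, where $d$ is the number of lines, $k$ is the number of smooth conics, and $t_j$ is the number of $j$-fold intersection points,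 i.e. points through which exactly $j$ components of the arrangement pass. Entries $t_j$ that are not listed are $0$. **Jacobian syzygies.** For a homogeneous polynomial $f \in S$ with partial derivatives $f_x, f_y, f_z$, put $J_f = \langle f_x, f_y, f_z\rangle$ and $M(f) = S/J_f$ (the Milnor algebra), and let $$AR(f) = \{(a,b,c) \in S^3 : a f_x + b f_y + c f_z = 0\}$$ be the graded $S$-module of Jacobian syzygies, where $AR(f)_r$ consists of the triples whose entries are homogeneous of degree $r$. The minimal degree of non-trivial Jacobian relations is $$\mathrm{mdr}(f) = \min\{r : AR(f)_r \neq (0)\}.$$ **Nearly free curves.** Let $C : f = 0$ be a reduced curve of degree $n$ in $\mathbb{P}^2_{\mathbb{C}}$. The curve $C$ is called $m$-syzygy if $M(f)$ has a minimal graded free resolution of the form $$0 \to \bigoplus_{i=1}^{m-2} S(-e_i) \to \bigoplus_{i=1}^{m} S(1-n-d_i) \to S^3(1-n) \to S$$ with $e_1 \leq \cdots \leq e_{m-2}$ and $1 \leq d_1 \leq \cdots \leq d_m$. The tuple $(d_1,\ldots,d_m)$ is called the exponents of $C$, and $d_1 = \mathrm{mdr}(f)$. The curve $C$ is nearly free if it is $3$-syzygy with $d_1 + d_2 = n$ and $d_2 = d_3$. *)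

(* Defs.v *)
From HB Require Import structures.
From mathcomp Require Import all_boot all_order all_algebra.
From mathcomp Require Import all_classical all_reals.
From mathcomp Require Import topology normedtype derive.
(* The notations of mpoly clash with those of MathComp-Analysis. *)
From mathcomp Require Import -(notations) mpoly.

Set Implicit Arguments.
Unset Strict Implicit.
Unset Printing Implicit Defensive.

Import Order.TTheory GRing.Theory Num.Theory numFieldNormedType.Exports.

Local Open Scope classical_set_scope.
Local Open Scope ring_scope.

(* Everything is defined over a field C of complex numbers; points of P^2 are
   represented by nonzero vectors p : 'rV[C]_3. *)

Definition homogeneous (n d : nat) (C : nzRingType) (f : mpoly n C) : Prop :=
  f \is ishomog1 d mdeg.

Definition eval (n : nat) (C : nzRingType) (f : mpoly n C) (p : 'rV[C]_n) : C :=
  meval (p 0) f.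

Definition partial (n : nat) (C : nzRingType) (i : 'I_n) (f : mpoly n C) :
  mpoly n C := mderiv i f.

Definition curve_degree (C : nzRingType) (f : mpoly 3 C) : nat := (msize f).-1.

Definition same_curve (C : fieldType) (f g : mpoly 3 C) : Prop :=
  exists2 c : C, c != 0 & f = c *: g.

Definition singular_point (C : fieldType) (f : mpoly 3 C) (p : 'rV[C]_3) :
    Prop :=
  [/\ p != 0, eval f p = 0 & forall i : 'I_3, eval (partial i f) p = 0].

Definition is_line (C : fieldType) (f : mpoly 3 C) : Prop :=
  f != 0 /\ homogeneous 1 f.

Definition is_smooth_conic (C : fieldType) (f : mpoly 3 C) : Prop :=
  [/\ f != 0, homogeneous 2 f & forall p, ~ singular_point f p].

Record conic_line_arrangement (C : fieldType) := ConicLineArrangement {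
  nlines : nat;
  nconics : nat;
  line : 'I_nlines -> mpoly 3 C;
  conic : 'I_nconics -> mpoly 3 C;
  nlines_gt0 : (0 < nlines)%N;
  nconics_gt0 : (0 < nconics)%N;
  lineP : forall i, is_line (line i);
  conicP : forall i, is_smooth_conic (conic i);
  lines_distinct : forall i j, i != j -> ~ same_curve (line i) (line j);
  conics_distinct : forall i j, i != j -> ~ same_curve (conic i) (conic j)
}.

Definition component (C : fieldType) (A : conic_line_arrangement C)
    (i : 'I_(nlines A) + 'I_(nconics A)) : mpoly 3 C :=
  match i with inl k => line k | inr k => conic k end.

Definition defining_polynomial (C : fieldType) (A : conic_line_arrangement C) :
    mpoly 3 C :=
  \prod_i component (A := A) i.

Definition defined_over_rat (C : fieldType) (A : conic_line_arrangement C) :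
    Prop :=
  forall i, exists g : mpoly 3 rat,
    same_curve (component (A := A) i) (map_mpoly ratr g).

(* The tangent line at p of a curve g smooth at p, as a plane in C^3. *)
Definition tangent_line (C : fieldType) (g : mpoly 3 C) (p : 'rV[C]_3) :
    set 'rV[C]_3 :=
  [set v | \sum_(i < 3) eval (partial i g) p * v 0 i = 0].

Definition ordinary_at (C : fieldType) (A : conic_line_arrangement C)
    (p : 'rV[C]_3) : Prop :=
  forall i j, i != j ->
    eval (component (A := A) i) p = 0 -> eval (component (A := A) j) p = 0 ->
    tangent_line (component (A := A) i) p <> tangent_line (component (A := A) j) p.

Definition multiplicity (C : fieldType) (A : conic_line_arrangement C)
    (p : 'rV[C]_3) : nat :=
  #|[pred i | eval (component (A := A) i) p == 0]|.

(* The set of j-fold points of A in P^2, the points of P^2 being here the lines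
   <[p]> of C^3, so that each one is counted once. *)
Definition multiple_points (C : fieldType) (A : conic_line_arrangement C)
    (j : nat) : set {vspace 'rV[C]_3} :=
  [set <[p]>%VS | p in [set p : 'rV[C]_3 | p != 0 /\ multiplicity A p = j]].

(* t lists t_2, t_3, ...; the entries beyond the end of t are 0. *)
Definition weak_combinatorics (C : fieldType) (A : conic_line_arrangement C)
    (d k : nat) (t : seq nat) : Prop :=
  [/\ nlines A = d, nconics A = k &
      forall j : nat, (multiple_points A j.+2 #= `I_(nth 0%N t j))%card].

(* Inverse of the standard affine chart x_i != 0 of P^2 (i.e. set x_i = 1). *)
Definition affine_chart (C : fieldType) (i : 'I_3) (q : 'rV[C]_2) : 'rV[C]_3 :=
  \row_j (if unlift i j is Some k then q 0 k else 1).

Definition affine_coord (C : fieldType) (i : 'I_3) (p : 'rV[C]_3) : 'rV[C]_2 :=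
  \row_k (p 0 (lift i k) / p 0 i).

Definition weighted_homogeneous (C : nzRingType) (w : 'I_2 -> nat) (N : nat)
    (g : mpoly 2 C) : Prop :=
  forall m, m \in msupp g -> (\sum_(k < 2) w k * m k)%N = N.

(* Over the complex numbers, Frechet differentiability with respect to C in a
   neighborhood of a is holomorphy at a. *)
Definition holomorphic_at (C : numFieldType) (V : normedModType C)
    (F : 'rV[C]_2 -> V) (a : 'rV[C]_2) : Prop :=
  \forall q \near a, differentiable F q.

Definition local_coordinates (C : numFieldType) (u : 'rV[C]_2 -> 'rV[C]_2)
    (a : 'rV[C]_2) : Prop :=
  [/\ u a = 0, holomorphic_at u a & jacobian u a \in unitmx].

(* In local coordinates u at p, the germ of the curve f = 0 is the germ of
   g = 0: the local equations agree up to a unit h of the local ring. *)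
Definition quasi_homogeneous_at (C : numFieldType) (f : mpoly 3 C)
    (p : 'rV[C]_3) : Prop :=
  exists2 i : 'I_3, p 0 i != 0 &
  let a := affine_coord i p in
  exists (w : 'I_2 -> nat) (N : nat) (g : mpoly 2 C)
         (u : 'rV[C]_2 -> 'rV[C]_2) (h : 'rV[C]_2 -> C),
    [/\ forall k, (0 < w k)%N, weighted_homogeneous w N g,
        local_coordinates u a, holomorphic_at h a /\ h a != 0 &
        \forall q \near a, eval f (affine_chart i q) = h q * eval g (u q)].

Definition only_ordinary_quasi_homogeneous_singularities (C : numFieldType)
    (A : conic_line_arrangement C) : Prop :=
  forall p, singular_point (defining_polynomial A) p ->
    ordinary_at A p /\ quasi_homogeneous_at (defining_polynomial A) p.

(* AR(f)_r <> 0 *)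
Definition nontrivial_syzygy_degree (C : fieldType) (f : mpoly 3 C) (r : nat) :
    Prop :=
  exists a : 'rV[mpoly 3 C]_3,
    [/\ a != 0, forall i, homogeneous r (a 0 i) &
        \sum_(i < 3) a 0 i * partial i f = 0].

Definition is_mdr (C : fieldType) (f : mpoly 3 C) (r : nat) : Prop :=
  nontrivial_syzygy_degree f r /\
  forall s, nontrivial_syzygy_degree f s -> (r <= s)%N.

(* By mdrP below, the default value 0 plays no role for homogeneous f. *)
Definition mdr (C : fieldType) (f : mpoly 3 C) : nat :=
  xget 0%N [set r | is_mdr f r].

Lemma is_mdr_uniq (C : fieldType) (f : mpoly 3 C) (r s : nat) :
  is_mdr f r -> is_mdr f s -> r = s.
Proof.
by move=> [hr mr] [hs ms]; apply/eqP; rewrite eqn_leq (mr _ hs) (ms _ hr).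
Qed.

Lemma homogeneous_partial (C : fieldType) (d : nat) (f : mpoly 3 C) i :
  homogeneous d f -> homogeneous d.-1 (partial i f).
Proof.
move=> /dhomogP hf; apply/dhomogP => m; rewrite mcoeff_msupp mcoeff_deriv => hm.
have : mnm_add m (mnm1 i) \in msupp f.
  by rewrite mcoeff_msupp; apply: contra_neq hm => ->; rewrite mul0rn.
by move=> /hf <-; rewrite /= mdegD mdeg1 addn1.
Qed.

Lemma mdrP (C : fieldType) (d : nat) (f : mpoly 3 C) :
  homogeneous d f -> is_mdr f (mdr f).
Proof.
move=> hf; rewrite /mdr.
suff [r hr] : exists r, nontrivial_syzygy_degree f r.
  suff [s hs] : exists s, is_mdr f s by apply: (xgetPex 0%N); exists s.
  have ex : exists r, `[< nontrivial_syzygy_degree f r >].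
    by exists r; apply/asboolP.
  case: (ex_minnP ex) => s /asboolP hs ms.
  by exists s; split=> // t ht; apply: ms; apply/asboolP.
have hom0 e : homogeneous e (0 : mpoly 3 C) by apply: dhomog0.
have [f0|] := pselect (forall i, partial i f = 0).
  exists 0%N, (\row_i 1); split.
  - by apply/eqP => /matrixP /(_ 0 0); rewrite !mxE => /eqP; rewrite oner_eq0.
  - by move=> i; rewrite mxE; apply: dhomog1.
  - by rewrite big1 // => i _; rewrite f0 mulr0.
move=> /existsNP [i /eqP fi0].
exists d.-1.
pose j : 'I_3 := lift i 0.
have ji : j != i by rewrite eq_sym neq_lift.
exists (\row_k (if k == i then - partial j f
                else if k == j then partial i f else 0)); split.
- by apply/eqP => /matrixP /(_ 0 j); rewrite !mxE (negbTE ji) eqxx; apply/eqP.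
- move=> k; rewrite mxE; case: ifP => _.
    by rewrite /homogeneous rpredN; apply: homogeneous_partial.
  by case: ifP => _; [apply: homogeneous_partial | apply: hom0].
- rewrite (bigD1 i) //= (bigD1 j) //= !mxE eqxx (negbTE ji) eqxx big1 ?addr0.
    by rewrite mulNr mulrC addNr.
  by move=> k /andP [ki kj]; rewrite mxE (negbTE ki) (negbTE kj) mul0r.
Qed.

Definition jacobian_ideal (C : fieldType) (f : mpoly 3 C) : set (mpoly 3 C) :=
  [set h | exists a : 'I_3 -> mpoly 3 C, h = \sum_(i < 3) a i * partial i f].

(* Maps of free S-modules act on row vectors. A degree 0 map
   (+)_i S(-a_i) -> (+)_j S(-b_j) is a matrix whose (i, j) entry is homogeneous
   of degree a_i - b_j, and is therefore 0 if a_i < b_j. *)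
Definition graded_map (C : fieldType) (p q : nat) (a : 'I_p -> nat)
    (b : 'I_q -> nat) (M : 'M[mpoly 3 C]_(p, q)) : Prop :=
  forall i j m, m \in msupp (M i j) -> (mdeg m + b j)%N = a i.

(* The image lies in the irrelevant ideal times the target. *)
Definition minimal_map (C : fieldType) (p q : nat) (M : 'M[mpoly 3 C]_(p, q)) :
    Prop :=
  forall i j, mcoeff (@mnm0 3) (M i j) = 0.

Definition exact_at (C : fieldType) (p q r : nat) (M : 'M[mpoly 3 C]_(p, q))
    (N : 'M[mpoly 3 C]_(q, r)) : Prop :=
  forall v : 'rV_q, v *m N = 0 <-> exists u : 'rV_p, v = u *m M.

(* f = 0 is an m-syzygy curve with exponents d. A resolution of S / J_f whose
   first term is S is one whose last map B1 has image J_f. The twists e_i need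
   only range over nat: e_i < 0 would force a zero row in the injective map B3. *)
Definition syzygy_curve (C : fieldType) (m : nat) (f : mpoly 3 C)
    (d : m.-tuple nat) : Prop :=
  let n := curve_degree f in
  exists (e : (m - 2).-tuple nat)
    (B3 : 'M[mpoly 3 C]_(m - 2, m)) (B2 : 'M[mpoly 3 C]_(m, 3))
    (B1 : 'M[mpoly 3 C]_(3, 1)),
  [/\ [/\ sorted leq e, sorted leq d & all (leq 1) d],
      [/\ graded_map (tnth e) (fun i => n.-1 + tnth d i)%N B3,
          graded_map (fun i => n.-1 + tnth d i)%N (fun=> n.-1) B2 &
          graded_map (fun=> n.-1) (fun=> 0%N) B1],
      [/\ minimal_map B3, minimal_map B2 & minimal_map B1] &
      [/\ forall u : 'rV_(m - 2), u *m B3 = 0 -> u = 0,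
          exact_at B3 B2, exact_at B2 B1 &
          [set h | exists u : 'rV_3, u *m B1 = h%:M] = jacobian_ideal f]].

Definition nearly_free (C : fieldType) (f : mpoly 3 C) : Prop :=
  exists d1 d2 d3 : nat,
    [/\ syzygy_curve f [tuple d1; d2; d3],
        (d1 + d2)%N = curve_degree f & d2 = d3].

(* Main.v *)
From mathcomp Require Import all_boot all_order all_algebra.
From mathcomp Require Import ring complex.
From mathcomp Require Import all_classical all_reals.
From mathcomp Require Import topology normedtype derive.
From mathcomp Require Import -(notations) mpoly.
Require Import Defs.

(* Both arrangements consist of the conic xy = z^2 and of six of its chords.

   Nearly freeness. In both cases there are three syzygies r0, r1, r2 of grad f
   with z^n r0 + x r1 + y r2 = 0 and r0 x r1 = kappa y grad f, of degrees
   (3, 5, 5) with n = 3, and (4, 4, 4) with n = 1. They generate AR(f): if s is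
   a syzygy, then s x r_i = h_i grad f with polynomial h_i (this uses that f is
   reduced), the relation gives z^n h0 + x h1 + y h2 = 0, and exactness of the
   Koszul complex of (z^n, x, y) expresses the h_i, hence s, by the r_i. As the
   relation is the only one, this is the minimal resolution, and mdr is the
   degree of r0.

   Singularities. A point off the conic is an ordinary point of a line
   arrangement, hence homogeneous in affine coordinates. At a point of the conic
   through which at most three lines pass, a polynomial change of coordinates
   straightens the conic while keeping these lines.

   Combinatorics. All intersection points are rational, so that incidences
   reduce to computations with integer vectors. *)

Set Implicit Arguments.
Unset Strict Implicit.
Unset Printing Implicit Defensive.

Import Order.TTheory GRing.Theory Num.Theory numFieldNormedType.Exports.

Local Open Scope ring_scope.

Local Notation i0 := (@Ordinal 3 0 isT).
Local Notation i1 := (@Ordinal 3 1 isT).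
Local Notation i2 := (@Ordinal 3 2 isT).
Local Notation "''X_' i" := (mpolyX _ (mnm1 i))
  (at level 8, i at level 2, format "''X_' i").

(** Only linear forms are shown to be prime, their multiples being kernels of substitutions. The
    conic is never shown to be irreducible: its derivative in x is the linear form y, a prime that
    does not divide it, and cancelling this form after differentiation replaces irreducibility.
    This, the coprimality of the factors and Euler's formula in characteristic zero are what
    reducedness of f amounts to here.

    The shape (z^n, x, y) of the relation is a normal form: replacing r1 and r2 by r1 + g r0 and r2
    + g' r0 removes from the entry at r0 everything that lies in the ideal (x, y). Given the
    relation, the identity for r0 x r1 implies those for r1 x r2 and r2 x r0, so that each example
    rests on two families of explicit polynomial identities.

    The bound of three lines at a point of the conic reflects a fact about germs: an ordinary point
    with four smooth branches is homogeneous in suitable coordinates, while with five branches terms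
    of higher order can be an obstruction. *)

Lemma ord3P (i : 'I_3) : [\/ i = i0, i = i1 | i = i2].
Proof.
by case: i => -[|[|[|//]]] lti; [apply: Or31|apply: Or32|apply: Or33];
  apply: val_inj.
Qed.

Lemma big_ord3 (R : Type) (idx : R) (op : Monoid.law idx) (F : 'I_3 -> R) :
  \big[op/idx]_i F i = op (op (F i0) (F i1)) (F i2).
Proof.
rewrite !big_ord_recl big_ord0 Monoid.mulm1 Monoid.mulmA.
by congr (op (op (F _) (F _)) (F _)); apply: val_inj.
Qed.

(** * Cross products of triples over a commutative ring *)

Definition cross (R : pzRingType) (a b : 'I_3 -> R) (k : 'I_3) : R :=
  match val k with
  | 0%N => a i1 * b i2 - a i2 * b i1
  | 1%N => a i2 * b i0 - a i0 * b i2
  | _ => a i0 * b i1 - a i1 * b i0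
  end.

Lemma crossC (R : comPzRingType) (a b : 'I_3 -> R) k :
  cross a b k = - cross b a k.
Proof. by rewrite /cross; case: (ord3P k) => -> /=; ring. Qed.

Lemma cross_eq0 (R : comPzRingType) (a b : 'I_3 -> R) :
  (forall k, cross a b k = 0) -> forall i j, a i * b j = a j * b i.
Proof.
move=> ab0 i j; apply/subr0_eq.
case: (ord3P i) => ->; case: (ord3P j) => ->; rewrite ?subrr //.
- exact: (ab0 i2).
- by have := ab0 i1; rewrite /cross /= => /(congr1 -%R); rewrite opprB oppr0.
- by have := ab0 i2; rewrite /cross /= => /(congr1 -%R); rewrite opprB oppr0.
- exact: (ab0 i0).
- exact: (ab0 i1).
- by have := ab0 i0; rewrite /cross /= => /(congr1 -%R); rewrite opprB oppr0.
Qed.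

(** A vector parallel to both [a] and [b] can survive only where [a] and [b] are dependent. Over a
    domain, one nonzero entry of [cross a b] therefore forces [s] to vanish. *)
Lemma mulr_cross_eq0 (R : comPzRingType) (s a b : 'I_3 -> R) :
  (forall k, cross s a k = 0) -> (forall k, cross s b k = 0) ->
  forall i k, s i * cross a b k = 0.
Proof.
move=> /cross_eq0 sa /cross_eq0 sb i k.
have swap p q : s i * (a p * b q - a q * b p) = a i * (s p * b q - s q * b p).
  by rewrite mulrBr !mulrA (sa i) (sa i q) -!mulrA -!(mulrCA (a i)) -mulrBr.
rewrite /cross; case: (ord3P k) => -> /=; rewrite swap.
- by rewrite (sb i1 i2) subrr mulr0.
- by rewrite (sb i2 i0) subrr mulr0.
- by rewrite (sb i0 i1) subrr mulr0.
Qed.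

Lemma cross_cross (R : comPzRingType) (a b c : 'I_3 -> R) j :
  cross (cross a b) c j = b j * (\sum_k a k * c k) - a j * (\sum_k b k * c k).
Proof. by rewrite /cross !big_ord3; case: (ord3P j) => -> /=; ring. Qed.

Lemma mpoly_ring_ind (n : nat) (R : comNzRingType) (P : mpoly n R -> Prop) :
  (forall c, P (mpolyC n c)) -> (forall i, P 'X_i) ->
  (forall p q, P p -> P q -> P (p + q)) ->
  (forall p q, P p -> P q -> P (p * q)) -> forall p, P p.
Proof.
move=> PC PX PD PM p; rewrite (mpolyE p).
apply: (big_ind P) => [||m _]; [by rewrite -(mpolyC0 n); exact: PC|exact: PD|].
rewrite -mul_mpolyC; apply: (PM) => //; rewrite mpolyXE_id.
have P1 : P 1 by rewrite -(mpolyC1 n).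
apply: (big_ind P P1 PM) => i _; elim: (m i) => [|k IHk]; first by rewrite expr0.
by rewrite exprS; apply: PM.
Qed.

(** * Divisibility by linear forms *)

Section Divisibility.
Variable R : idomainType.
Implicit Types p q d u : R.

Definition mdvd d p := exists q, p = q * d.

(** Units satisfy this predicate, so [~ mdvd d 1] is a separate hypothesis where products are
    concerned. *)
Definition prime_elt d := d != 0 /\
  forall p q, mdvd d (p * q) -> mdvd d p \/ mdvd d q.

Lemma mdvd_mull d p q : mdvd d q -> mdvd d (p * q).
Proof. by move=> [r ->]; exists (p * r); rewrite mulrA. Qed.

Lemma mdvdD d p q : mdvd d p -> mdvd d q -> mdvd d (p + q).
Proof. by move=> [r ->] [s ->]; exists (r + s); rewrite mulrDl. Qed.

Lemma mdvdB d p q : mdvd d p -> mdvd d q -> mdvd d (p - q).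
Proof. by move=> [r ->] [s ->]; exists (r - s); rewrite mulrBl. Qed.

Lemma prime_eltM_cancel d p q : prime_elt d -> ~ mdvd d q ->
  mdvd d (p * q) -> mdvd d p.
Proof. by move=> [_ dP] dq /dP[]. Qed.

Lemma prime_elt_prod (I : Type) (r : seq I) (P : pred I) (F : I -> R) d :
  prime_elt d -> ~ mdvd d 1 -> (forall i, P i -> ~ mdvd d (F i)) ->
  ~ mdvd d (\prod_(i <- r | P i) F i).
Proof.
move=> dP d1 dF; apply: (big_ind (fun p => ~ mdvd d p)) => //.
by move=> p q dp dq /(proj2 dP)[].
Qed.

(* Here c need not be prime: if p d = q c then d divides q. *)
Lemma mdvd_cancel_prime c d p : prime_elt d -> ~ mdvd d c ->
  mdvd c (p * d) -> mdvd c p.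
Proof.
move=> dP dc [q pdE]; have : mdvd d (q * c) by exists p.
case/(prime_eltM_cancel dP dc) => r qE; exists r.
by apply: (mulIf (proj1 dP)); rewrite pdE qE mulrAC.
Qed.

Lemma mdvd_cancel_prod (I : Type) (r : seq I) (F : I -> R) c p :
  (forall i, prime_elt (F i)) -> (forall i, ~ mdvd (F i) c) ->
  mdvd c (p * \prod_(i <- r) F i) -> mdvd c p.
Proof.
move=> FP Fc; elim: r p => [|i r IHr] p; first by rewrite big_nil mulr1.
by rewrite big_cons mulrA => /IHr; apply: mdvd_cancel_prime.
Qed.

(** Each new prime divides neither [c] nor the factors already collected, so it must divide the
    cofactor. Primality of [c] is not assumed, in view of the conic. *)
Lemma mdvd_prod (I : eqType) (r : seq I) (F : I -> R) c p :
  uniq r -> (forall i, prime_elt (F i)) -> (forall i, ~ mdvd (F i) 1) ->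
  (forall i, ~ mdvd (F i) c) -> (forall i j, i != j -> ~ mdvd (F i) (F j)) ->
  mdvd c p -> (forall i, mdvd (F i) p) -> mdvd (c * \prod_(i <- r) F i) p.
Proof.
move=> + FP F1 Fc FF cp Fp; elim: r => [|i r IHr] /=.
  by rewrite big_nil mulr1.
case/andP=> ir /IHr[q pE]; rewrite big_cons; have := Fp i.
rewrite [in mdvd _ p]pE => /(prime_eltM_cancel (FP i))[] => [|s qE].
  case/(proj2 (FP i)); first exact: Fc.
  rewrite big_seq; apply: (prime_elt_prod (FP i)) => // j jr; apply: FF.
  by apply: contraNneq ir => ->.
by exists s; rewrite pE qE -!mulrA; congr (_ * _); rewrite mulrCA.
Qed.

End Divisibility.

Section Substitution.
Variables (n : nat) (C : fieldType).

(** [I] stands for an ideal; it is used for the multiples of a linear form and for the ideal (x,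
    y). *)
Lemma comp_mpoly_congr (lq : n.-tuple (mpoly n C)) (I : mpoly n C -> Prop) :
  I 0 -> (forall p q, I p -> I q -> I (p + q)) ->
  (forall p q, I q -> I (p * q)) ->
  (forall i, I ('X_i - tnth lq i)) -> forall p, I (p - comp_mpoly lq p).
Proof.
move=> I0 ID IM IX; apply: mpoly_ring_ind => [c|i|p q Ip Iq|p q Ip Iq].
- by rewrite comp_mpolyC subrr.
- by rewrite comp_mpolyXU -tnth_nth.
- by rewrite comp_mpolyD opprD addrACA; apply: ID.
- have -> : p * q - comp_mpoly lq (p * q) =
    q * (p - comp_mpoly lq p) + comp_mpoly lq p * (q - comp_mpoly lq q).
    by rewrite rmorphM /=; ring.
  by apply: ID; apply: IM.
Qed.

End Substitution.

Section LinearForms.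
Variable C : fieldType.
Local Notation S := (mpoly 3 C).
Implicit Types (a b : 'rV[C]_3) (p q : S).

Definition linform a : S := \sum_i a 0 i *: 'X_i.

Lemma partial_linform a i : partial i (linform a) = mpolyC 3 (a 0 i).
Proof.
rewrite /partial /linform raddf_sum /= (bigD1 i) //= big1 => [|j /negbTE ji].
  rewrite addr0 mderivZ mderivX mnm1E eqxx scale1r.
  have -> : mnm_sub (mnm1 i) (mnm1 i) = @mnm0 3.
    by apply/mnmP => k; rewrite mnmBE mnm0E subnn.
  by rewrite mpolyX0 -mul_mpolyC mulr1.
by rewrite mderivZ mderivX mnm1E ji scale0r scaler0.
Qed.

Lemma eval_linform a v : eval (linform a) v = \sum_i a 0 i * v 0 i.
Proof.
rewrite /eval /linform raddf_sum; apply: eq_bigr => i _.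
by rewrite /= mevalZ mevalXU.
Qed.

Lemma homogeneous_linform a : homogeneous 1 (linform a).
Proof.
by apply: rpred_sum => i _; apply: rpredZ; rewrite dhomogX /= mdeg1.
Qed.

Lemma linform_eq0 a : (linform a == 0) = (a == 0).
Proof.
apply/eqP/eqP => [l0|->]; last first.
  by rewrite /linform big1 // => i _; rewrite mxE scale0r.
apply/rowP => i; have /(congr1 (partial i)) := l0.
rewrite partial_linform /partial raddf0 mxE => /eqP.
by rewrite mpolyC_eq0 => /eqP.
Qed.

(** The morphism solves the equation l = 0 for a variable [X_k] with nonzero coefficient and
    substitutes the solution. Its kernel being the multiples of l, primality of l follows from S
    being a domain. *)
Lemma mdvd_linformP a : a != 0 -> exists f : {rmorphism S -> S},
  forall p, mdvd (linform a) p <-> f p = 0.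
Proof.
move=> /rV0Pn[k ak]; set l := linform a.
pose lq := [tuple 'X_i - (if i == k then (a 0 k)^-1 *: l else 0) | i < 3].
have lqE i : comp_mpoly lq 'X_i =
    'X_i - (if i == k then (a 0 k)^-1 *: l else 0).
  by rewrite comp_mpolyXU -tnth_nth tnth_mktuple.
have fl : comp_mpoly lq l = 0.
  rewrite /l /linform raddf_sum /=.
  under eq_bigr do rewrite comp_mpolyZ lqE scalerBr.
  rewrite sumrB -/(linform a) -/l (bigD1 k) //= eqxx big1 => [|i /negbTE ->].
    by rewrite addr0 scalerA divff // scale1r subrr.
  by rewrite scaler0.
exists (comp_mpoly lq) => p; split=> [[q ->]|fp0].
  by rewrite rmorphM /= fl mulr0.
rewrite -[p]subr0 -fp0; apply: comp_mpoly_congr => {p fp0}.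
- by exists 0; rewrite mul0r.
- exact: mdvdD.
- exact: mdvd_mull.
move=> i; rewrite tnth_mktuple opprB addrC subrK.
case: ifP => _; first by exists (mpolyC 3 (a 0 k)^-1); rewrite mul_mpolyC.
by exists 0; rewrite mul0r.
Qed.

Lemma prime_linform a : a != 0 -> prime_elt (linform a).
Proof.
move=> a0; split=> [|p q]; first by rewrite linform_eq0.
have [f fP] := mdvd_linformP a0; rewrite !fP rmorphM => /eqP.
by rewrite mulf_eq0 => /orP[] /eqP; [left|right].
Qed.

Lemma mdvd_eval p q v : mdvd p q -> eval p v = 0 -> eval q v = 0.
Proof. by move=> [r ->] p0; rewrite /eval mevalM [meval _ p]p0 mulr0. Qed.

End LinearForms.

(** * Exactness of the Koszul complex of (z^n, x, y) *)

Section Koszul.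
Variable C : fieldType.
Local Notation S := (mpoly 3 C).
Local Notation x := ('X_i0 : S).
Local Notation y := ('X_i1 : S).
Local Notation z := ('X_i2 : S).

Lemma mX_neq0 i : ('X_i : S) != 0.
Proof. by rewrite -msize_poly_eq0 msizeX. Qed.

Lemma X_linform i : 'X_i = linform (delta_mx 0 i) :> S.
Proof.
rewrite /linform (bigD1 i) //= big1 => [|j /negbTE ji]; rewrite mxE eqxx.
  by rewrite eqxx scale1r addr0.
by rewrite ji scale0r.
Qed.

Lemma prime_X i : prime_elt ('X_i : S).
Proof.
rewrite X_linform; apply: prime_linform; rewrite -linform_eq0 -X_linform.
exact: mX_neq0.
Qed.

Lemma X_ndvd_X i j : i != j -> ~ mdvd ('X_i : S) 'X_j.
Proof.
move=> /negbTE ij /(mdvd_eval (v := delta_mx 0 j)).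
rewrite /eval !mevalXU !mxE ij !eqxx => /(_ erefl)/eqP.
by rewrite oner_eq0.
Qed.

(** Setting x = y = 0 in the relation leaves z^n times the image of h0, so h0 lies in (x, y).
    Substituting this gives an equality between a multiple of x and a multiple of y, and x is a
    prime that does not divide y. *)
Lemma koszul_xyz n (h0 h1 h2 : S) :
  z ^+ n * h0 + x * h1 + y * h2 = 0 ->
  exists k0 k1 k2, [/\ h0 = x * k2 - y * k1, h1 = y * k0 - z ^+ n * k2 &
                       h2 = z ^+ n * k1 - x * k0].
Proof.
move=> E; pose lq := [tuple if i == i2 then 'X_i else 0 : S | i < 3].
have /(_ h0)[k2 [k1 h0E]] : forall p, exists u w,
    p - comp_mpoly lq p = x * u - y * w.
  apply: (@comp_mpoly_congr _ _ lq (fun q => exists u w, q = x * u - y * w)).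
  - by exists 0, 0; rewrite !mulr0 subr0.
  - by move=> p q [u [w ->]] [u' [w' ->]]; exists (u + u'), (w + w'); ring.
  - by move=> p q [u [w ->]]; exists (p * u), (p * w); ring.
  move=> i; rewrite tnth_mktuple.
  case: (ord3P i) => -> /=; [exists 1, 0|exists 0, (-1)|exists 0, 0]; ring.
have lqX i : comp_mpoly lq 'X_i = if i == i2 then 'X_i else 0.
  by rewrite comp_mpolyXU -tnth_nth tnth_mktuple.
have h00 : comp_mpoly lq h0 = 0.
  have /eqP := congr1 (comp_mpoly lq) E.
  rewrite !(rmorphD, rmorphM, rmorphXn, rmorph0) /= !lqX /= !mul0r !addr0.
  by rewrite mulf_eq0 expf_eq0 (negbTE (mX_neq0 _)) andbF => /eqP.
move: h0E; rewrite h00 subr0 => h0E.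
have E' : x * (h1 + z ^+ n * k2) = y * (z ^+ n * k1 - h2).
  by rewrite -[RHS]addr0 -[in RHS]E h0E; ring.
have [k0 k0E] : mdvd x (z ^+ n * k1 - h2).
  apply: (prime_eltM_cancel (prime_X i0) (@X_ndvd_X i0 i1 isT)).
  by exists (h1 + z ^+ n * k2); rewrite mulrC -E' mulrC.
exists k0, k1, k2; split=> //.
  apply: (mulfI (mX_neq0 i0)); rewrite -[LHS](addrK (x * (z ^+ n * k2))).
  by rewrite -mulrDr E' k0E; ring.
by rewrite [x * k0]mulrC -k0E opprB addrC subrK.
Qed.

End Koszul.

(** * Syzygies of a product of lines and a conic *)

Lemma euler_homogeneous (C : fieldType) d (p : mpoly 3 C) : homogeneous d p ->
  \sum_i 'X_i * partial i p = d%:R *: p.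
Proof.
move=> /dhomogP hp; rewrite [in RHS](mpolyE p) scaler_sumr.
under eq_bigr do rewrite /partial [in mderiv _ _](mpolyE p) raddf_sum mulr_sumr.
rewrite exchange_big; apply: eq_big_seq => m /hp /= <-.
rewrite mdegE natr_sum scaler_suml; apply: eq_bigr => i _ /=.
rewrite mderivZ mderivX -!scalerAr -mpolyXD [RHS]scalerA [in RHS]mulrC -scalerA.
have [->|mi0] := eqVneq (m i) 0%N; first by rewrite !scale0r.
congr (_ *: (_ *: mpolyX _ _)).
by rewrite addmC submK // lep1mP.
Qed.

Section Syzygies.
Variables (C : numFieldType) (m : nat) (l : 'I_m -> 'rV[C]_3) (c : mpoly 3 C).
Local Notation S := (mpoly 3 C).
Local Notation f := (c * \prod_i linform (l i)).

Hypothesis l_neq0 : forall i, l i != 0.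
Hypothesis l_ndvd_l : forall i j, i != j ->
  ~ mdvd (linform (l i)) (linform (l j)).
Hypothesis l_ndvd_c : forall i, ~ mdvd (linform (l i)) c.
Hypothesis c_homog : homogeneous 2 c.
Hypothesis c_partial : exists k b,
  [/\ b != 0, partial k c = linform b & ~ mdvd (linform b) c].

Lemma homogeneous_product : homogeneous (2 + m) f.
Proof.
apply: dhomogM => //.
suff : homogeneous (\sum_(i < m) 1)%N (\prod_i linform (l i)).
  by rewrite sum1_card card_ord.
apply: (big_ind2 (fun d (p : S) => homogeneous d p)) => [|d p e q|i _].
- exact: dhomog1.
- exact: dhomogM.
- exact: homogeneous_linform.
Qed.

Lemma l_ndvd_1 i : ~ mdvd (linform (l i)) 1.
Proof. by move=> /(mdvd_mull c); rewrite mulr1; apply: l_ndvd_c. Qed.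

(** For a line l write f = F l. Modulo l, [partial k f] is F times the coefficient of [X_k] in l;
    choosing k with a nonzero coefficient, the prime l divides D F and does not divide F, hence
    divides D. The conic is treated separately, and the divisors are assembled by [mdvd_prod]. *)
Lemma mdvd_f (D : S) : (forall i, mdvd f (D * partial i f)) -> mdvd f D.
Proof.
move=> fD; have lP i : prime_elt (linform (l i)) by apply: prime_linform.
have lD i : mdvd (linform (l i)) D.
  have /rV0Pn[k lik] := l_neq0 i.
  pose F := c * \prod_(j | j != i) linform (l j).
  have fE : f = F * linform (l i) by rewrite (bigD1 i) //= mulrCA mulrC.
  have lF : ~ mdvd (linform (l i)) F.
    move=> /(proj2 (lP i))[]; first exact: l_ndvd_c.
    apply: (prime_elt_prod (lP i) (@l_ndvd_1 i)) => j.
    by rewrite eq_sym; apply: l_ndvd_l.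
  apply: (prime_eltM_cancel (lP i) lF).
  have : mdvd (linform (l i)) (D * partial k f).
    by have [q ->] := fD k; apply/mdvd_mull; exists F.
  rewrite {1}fE /partial mderivM [mderiv k (linform _)]partial_linform => lDf.
  have [q qE] : mdvd (linform (l i)) (D * (F * mpolyC 3 (l i 0 k))).
    have -> : D * (F * mpolyC 3 (l i 0 k)) =
        D * (mderiv k F * linform (l i) + F * mpolyC 3 (l i 0 k)) -
        D * mderiv k F * linform (l i) by ring.
    by apply: mdvdB => //; exists (D * mderiv k F).
  exists (q * mpolyC 3 (l i 0 k)^-1); rewrite mulrAC -qE -!mulrA -mpolyCM.
  by rewrite divff // mpolyC1 mulr1.
(* Modulo [c], [partial k f] is [linform b] times the product of the lines. All these factors are
   primes that do not divide [c], and they are cancelled one after the other. *)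
have cD : mdvd c D.
  have [k [b [b0 kc bc]]] := c_partial.
  apply: (mdvd_cancel_prod (r := index_enum 'I_m) lP l_ndvd_c).
  apply: (mdvd_cancel_prime (prime_linform b0) bc).
  have [q qE] := fD k; rewrite -kc.
  exists (q * \prod_i linform (l i) - D * mderiv k (\prod_i linform (l i))).
  have := qE; rewrite /partial mderivM; set P := \prod_i _ => qE'.
  rewrite mulrBl -[q * P * c]mulrA [P * c]mulrC -qE'; ring.
rewrite -mulrC [in mdvd _ _]mulrC.
apply: mdvd_prod => //; first exact: index_enum_uniq.
exact: l_ndvd_1.
Qed.

(* Both syzygies are orthogonal to grad f, so their cross product w is
   proportional to it; since (x . w) f_i = (2 + m) f w_i by Euler's formula,
   w is a polynomial multiple of grad f as soon as f divides x . w *)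
Lemma syzygy_cross (a b : 'I_3 -> S) :
  \sum_i a i * partial i f = 0 -> \sum_i b i * partial i f = 0 ->
  exists h, forall k, cross a b k = h * partial k f.
Proof.
have N0 : (2 + m)%:R != 0 :> C by rewrite pnatr_eq0.
have f_neq0 : f != 0.
  rewrite mulf_neq0 //; last by apply/prodf_neq0 => i _; rewrite linform_eq0.
  have [k [b' [b0 kc bc]]] := c_partial; apply: contra_notN bc => /eqP ->.
  by exists 0; rewrite mul0r.
have := euler_homogeneous homogeneous_product.
have := mdvd_f; rewrite !big_ord3 /=; set g := c * _ in f_neq0 *.
set N := (2 + m)%:R in N0 *; move=> fdvd euler sa sb.
pose D := 'X_i0 * (a i1 * b i2 - a i2 * b i1) +
  'X_i1 * (a i2 * b i0 - a i0 * b i2) + 'X_i2 * (a i0 * b i1 - a i1 * b i0).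
(* The two sides differ by a combination of the relations [sa] and [sb]; the coefficients are, up to
   sign, entries of the cross products of (x, y, z) with [b] and with [a]. The same holds for the
   other two entries. *)
have Df0 : D * partial i0 g = N *: g * (a i1 * b i2 - a i2 * b i1).
  rewrite -euler -[RHS]addr0 -(mulr0 ('X_i2 * b i1 - 'X_i1 * b i2)) -sa.
  by rewrite -[RHS]addr0 -(mulr0 ('X_i1 * a i2 - 'X_i2 * a i1)) -sb /D; ring.
have Df1 : D * partial i1 g = N *: g * (a i2 * b i0 - a i0 * b i2).
  rewrite -euler -[RHS]addr0 -(mulr0 ('X_i0 * b i2 - 'X_i2 * b i0)) -sa.
  by rewrite -[RHS]addr0 -(mulr0 ('X_i2 * a i0 - 'X_i0 * a i2)) -sb /D; ring.
have Df2 : D * partial i2 g = N *: g * (a i0 * b i1 - a i1 * b i0).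
  rewrite -euler -[RHS]addr0 -(mulr0 ('X_i1 * b i0 - 'X_i0 * b i1)) -sa.
  by rewrite -[RHS]addr0 -(mulr0 ('X_i0 * a i1 - 'X_i1 * a i0)) -sb /D; ring.
have [i|h hD] := fdvd D.
  case: (ord3P i) => ->; rewrite ?Df0 ?Df1 ?Df2 -scalerAl mulrC scalerAl;
  by eexists.
have w_eq w p : D * p = N *: g * w -> w = N^-1 *: h * p.
  move=> Dp; apply: (mulfI f_neq0); apply: (scalerI N0).
  by rewrite scalerAl -Dp hD -scalerAl -!scalerAr scalerA divff // scale1r; ring.
exists (N^-1 *: h) => k.
by case: (ord3P k) => ->; rewrite /cross /=; apply: w_eq.
Qed.

End Syzygies.

(** * Nearly free resolutions *)

Lemma homogeneous_curve_degree (C : fieldType) d (f : mpoly 3 C) :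
  f != 0 -> homogeneous d f -> curve_degree f = d.
Proof.
by move=> f0 fd; apply/esym/(dhomog_uniq f0 fd)/(dhomog_msize fd).
Qed.

Section NearlyFree.
Variables (C : fieldType) (f : mpoly 3 C) (d1 d2 n : nat) (kappa : C).
Local Notation S := (mpoly 3 C).
Local Notation x := ('X_i0 : S).
Local Notation y := ('X_i1 : S).
Local Notation z := ('X_i2 : S).
Variable r : 'M[S]_3.

Hypothesis f_neq0 : f != 0.
Hypothesis f_homog : homogeneous (d1 + d2) f.
Hypothesis f_sat : forall a b : 'I_3 -> S,
  \sum_i a i * partial i f = 0 -> \sum_i b i * partial i f = 0 ->
  exists h, forall k, cross a b k = h * partial k f.
Hypothesis grad_neq0 : exists i, partial i f != 0.
Hypothesis d1_gt0 : (0 < d1)%N.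
Hypothesis d12 : (d1 <= d2)%N.
Hypothesis n_deg : (n + d1 = d2.+1)%N.
Hypothesis kappa_neq0 : kappa != 0.
Hypothesis r_homog : forall i j, homogeneous (if i == i0 then d1 else d2) (r i j).
Hypothesis r_rel : forall j, z ^+ n * r i0 j + x * r i1 j + y * r i2 j = 0.
Hypothesis r_cross : forall k,
  cross (r i0) (r i1) k = mpolyC 3 kappa * y * partial k f.

Local Notation K := (mpolyC 3 kappa).

Lemma K_neq0 : K != 0. Proof. by rewrite mpolyC_eq0. Qed.

(** Rows r0 and r1 are orthogonal to their cross product, which is K y grad f, and K y can be
    cancelled. For r2, multiply by y and use the relation. *)
Lemma syzygy_rows i : \sum_j r i j * partial j f = 0.
Proof.
have w0 := r_cross i0; have w1 := r_cross i1; have w2 := r_cross i2.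
have Ky : K * y != 0 by rewrite mulf_neq0 ?K_neq0 ?mX_neq0.
have r0 : \sum_j r i0 j * partial j f = 0.
  apply: (mulfI Ky); rewrite mulr0 mulr_sumr big_ord3 /=.
  by rewrite !(mulrCA (K * y)) -w0 -w1 -w2 /cross /=; ring.
have r1 : \sum_j r i1 j * partial j f = 0.
  apply: (mulfI Ky); rewrite mulr0 mulr_sumr big_ord3 /=.
  by rewrite !(mulrCA (K * y)) -w0 -w1 -w2 /cross /=; ring.
case: (ord3P i) => -> //.
apply: (mulfI (mX_neq0 C i1)); rewrite mulr0.
have -> : y * (\sum_j r i2 j * partial j f) =
    z ^+ n * (\sum_j r i0 j * partial j f) + x * (\sum_j r i1 j * partial j f)
    + y * (\sum_j r i2 j * partial j f) by rewrite r0 r1 !mulr0 !add0r.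
rewrite !mulr_sumr -!big_split big1 //= => j _.
transitivity ((z ^+ n * r i0 j + x * r i1 j + y * r i2 j) * partial j f).
  by ring.
by rewrite r_rel mul0r.
Qed.

(** By the relation, y r2 = - z^n r0 - x r1, so y (r1 x r2) = z^n (r0 x r1), and y cancels. With the
    next lemma, the three cross products of rows are K grad f times z^n, x and y, the pattern of a
    Hilbert-Burch matrix. *)
Lemma cross_rows12 k : cross (r i1) (r i2) k = K * z ^+ n * partial k f.
Proof.
apply: (mulfI (mX_neq0 C i1)).
have -> : y * cross (r i1) (r i2) k =
    cross (r i1) (fun j => z ^+ n * r i0 j + x * r i1 j + y * r i2 j) k
    + z ^+ n * cross (r i0) (r i1) k.
  by rewrite /cross; case: (ord3P k) => -> /=; ring.
have -> : cross (r i1) (fun j => z ^+ n * r i0 j + x * r i1 j + y * r i2 j) k = 0.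
  by rewrite /cross; case: (ord3P k) => -> /=; rewrite !r_rel !mulr0 subrr.
by rewrite r_cross; ring.
Qed.

Lemma cross_rows20 k : cross (r i2) (r i0) k = K * x * partial k f.
Proof.
apply: (mulfI (mX_neq0 C i1)).
have -> : y * cross (r i2) (r i0) k =
    x * cross (r i0) (r i1) k -
    cross (r i0) (fun j => z ^+ n * r i0 j + x * r i1 j + y * r i2 j) k.
  by rewrite /cross; case: (ord3P k) => -> /=; ring.
have -> : cross (r i0) (fun j => z ^+ n * r i0 j + x * r i1 j + y * r i2 j) k = 0.
  by rewrite /cross; case: (ord3P k) => -> /=; rewrite !r_rel !mulr0 subrr.
by rewrite r_cross; ring.
Qed.

Lemma syzygy_generated (s : 'I_3 -> S) : \sum_j s j * partial j f = 0 ->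
  exists u : 'I_3 -> S, forall j, s j = \sum_i u i * r i j.
Proof.
move=> sf; have [k fk] := grad_neq0.
have [h0 h0E] := f_sat sf (syzygy_rows i0).
have [h1 h1E] := f_sat sf (syzygy_rows i1).
have [h2 h2E] := f_sat sf (syzygy_rows i2).
have : z ^+ n * h0 + x * h1 + y * h2 = 0.
  apply: (mulIf fk); rewrite mul0r !mulrDl -!mulrA -h0E -h1E -h2E.
  transitivity (cross s (fun j => z ^+ n * r i0 j + x * r i1 j + y * r i2 j) k).
    by rewrite /cross; case: (ord3P k) => -> /=; ring.
  by rewrite /cross; case: (ord3P k) => -> /=; rewrite !r_rel !mulr0 subrr.
move=> /koszul_xyz[k0 [k1 [k2 [e0 e1 e2]]]].
(* The cross products of this difference with r0 and r1 vanish, precisely by the Koszul expressions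
   of [h0] and [h1]. As r0 x r1 is nonzero, the difference is 0. *)
pose s' j := K * s j - (k0 * r i0 j + k1 * r i1 j + k2 * r i2 j).
have s'r0 j : cross s' (r i0) j = 0.
  transitivity (K * cross s (r i0) j + k1 * cross (r i0) (r i1) j
                - k2 * cross (r i2) (r i0) j).
    by rewrite /cross /s'; case: (ord3P j) => -> /=; ring.
  by rewrite h0E r_cross cross_rows20 e0; ring.
have s'r1 j : cross s' (r i1) j = 0.
  transitivity (K * cross s (r i1) j + k2 * cross (r i1) (r i2) j
                - k0 * cross (r i0) (r i1) j).
    by rewrite /cross /s'; case: (ord3P j) => -> /=; ring.
  by rewrite h1E r_cross cross_rows12 e1; ring.
have s'0 j : s' j = 0.
  apply: (mulIf (_ : K * y * partial k f != 0)).
    by rewrite !mulf_neq0 // ?K_neq0 ?mX_neq0.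
  by rewrite mul0r -r_cross; apply: mulr_cross_eq0.
pose K' := mpolyC 3 kappa^-1.
have K'K : K' * K = 1 by rewrite -mpolyCM mulVf // mpolyC1.
exists (fun i => K' * match val i with 0%N => k0 | 1%N => k1 | _ => k2 end) => j.
rewrite big_ord3 /= -[LHS]mul1r -K'K -mulrA (subr0_eq (s'0 j)); ring.
Qed.

(** Crossing the relation with r0 and with r1 and cancelling K times a nonzero partial derivative
    shows that u is proportional to (z^n, x, y). The factor is a polynomial because the prime x does
    not divide y. *)
Lemma relation_generated (u : 'I_3 -> S) : (forall j, \sum_i u i * r i j = 0) ->
  exists t, [/\ u i0 = t * z ^+ n, u i1 = t * x & u i2 = t * y].
Proof.
move=> ur; have [k fk] := grad_neq0.
have ur' j : u i0 * r i0 j + u i1 * r i1 j + u i2 * r i2 j = 0.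
  by rewrite -[RHS](ur j) big_ord3.
have Kf : K * partial k f != 0 by rewrite mulf_neq0 ?K_neq0.
have u12 : u i1 * y = u i2 * x.
  apply: (mulIf Kf); apply/subr0_eq.
  transitivity (u i1 * cross (r i0) (r i1) k - u i2 * cross (r i2) (r i0) k).
    by rewrite r_cross cross_rows20; ring.
  transitivity (cross (r i0)
    (fun j => u i0 * r i0 j + u i1 * r i1 j + u i2 * r i2 j) k).
    by rewrite /cross; case: (ord3P k) => -> /=; ring.
  by rewrite /cross; case: (ord3P k) => -> /=; rewrite !ur' !mulr0 subrr.
have u02 : u i0 * y = u i2 * z ^+ n.
  apply: (mulIf Kf); apply/subr0_eq.
  transitivity (u i0 * cross (r i0) (r i1) k - u i2 * cross (r i1) (r i2) k).
    by rewrite r_cross cross_rows12; ring.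
  transitivity (- cross (r i1)
    (fun j => u i0 * r i0 j + u i1 * r i1 j + u i2 * r i2 j) k).
    by rewrite /cross; case: (ord3P k) => -> /=; ring.
  by rewrite /cross; case: (ord3P k) => -> /=; rewrite !ur' !mulr0 subrr oppr0.
have [t u1E] : mdvd x (u i1).
  apply: (prime_eltM_cancel (prime_X C i0) (@X_ndvd_X C i0 i1 isT)).
  by exists (u i2).
have u2E : u i2 = t * y.
  by apply: (mulIf (mX_neq0 C i0)); rewrite -u12 u1E; ring.
exists t; split=> //; apply: (mulIf (mX_neq0 C i1)).
by rewrite u02 u2E; ring.
Qed.

Lemma r0_neq0 : row i0 r != 0.
Proof.
have [k fk] := grad_neq0; apply/eqP => /rowP r0.
have /eqP := r_cross k.
have r0j j : r i0 j = 0 by have := r0 j; rewrite !mxE.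
have -> : cross (r i0) (r i1) k = 0.
  by rewrite /cross; case: (ord3P k) => -> /=; rewrite !r0j !mul0r subrr.
by rewrite eq_sym !mulf_eq0 (negbTE fk) (negbTE K_neq0) (negbTE (mX_neq0 C _)).
Qed.

(** For minimality, a monomial of a nonzero syzygy is a multiple of a monomial of some entry of [r],
    whose degree is [d1] or [d2], hence at least [d1]. The coefficients u are arbitrary
    polynomials. *)
Lemma is_mdr_d1 : is_mdr f d1.
Proof.
split=> [|s [a [a0 ha af]]].
  exists (row i0 r); split; first exact: r0_neq0.
    by move=> j; rewrite mxE; apply: (r_homog i0).
  by under eq_bigr do rewrite mxE; apply: syzygy_rows.
have [u uE] := syzygy_generated af.
have /rV0Pn[j aj] := a0.
have [m mj] : exists m, m \in msupp (a 0 j).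
  move: aj; rewrite -msupp_eq0; case: (msupp _) => // m q _.
  by exists m; rewrite mem_head.
have <- := dhomog_mf (ha j) mj; move: mj; rewrite uE => /msupp_sum_le.
move=> /flattenP[_ /mapP[i _ ->]] /msuppM_le/allpairsP[[m1 m2] /= [_ m2r ->]].
rewrite mdegD (dhomog_mf (r_homog i j) m2r).
apply: leq_trans (leq_addl _ _); by case: ifP.
Qed.

Lemma nearly_free_resolution : nearly_free f.
Proof.
have fdeg := homogeneous_curve_degree f_neq0 f_homog.
exists d1, d2, d2; split=> //; rewrite /syzygy_curve fdeg.
set N := (d1 + d2).-1.
pose g : 'I_3 -> S := tnth [tuple z ^+ n; x; y].
have gE : [/\ g i0 = z ^+ n, g i1 = x & g i2 = y] by [].
have tnth_d i : tnth [tuple d1; d2; d2] i = if i == i0 then d1 else d2.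
  by case: (ord3P i) => ->.
have d2_gt0 : (0 < d2)%N by apply: leq_trans d12.
have n_gt0 : (0 < n)%N by rewrite lt0n; apply: contraTneq d12 => n0;
  rewrite -ltnNge -n_deg n0.
have g_homog i : homogeneous (if i == i0 then n else 1%N) (g i).
  case: (ord3P i) => -> /=; rewrite /g !(tnth_nth 0) /=; last 2 first.
  - by rewrite /homogeneous dhomogX /= mdeg1.
  - by rewrite /homogeneous dhomogX /= mdeg1.
  by rewrite -[n in homogeneous n _]mul1n; apply: dhomogMn; rewrite dhomogX /= mdeg1.
have r_homogN i j m : m \in msupp (r i j) ->
    (mdeg m + N = N + if i == i0 then d1 else d2)%N.
  by move=> /(dhomog_mf (r_homog i j)) /= ->; rewrite addnC.
have homog_min d p : (0 < d)%N -> homogeneous d p -> mcoeff (@mnm0 3) p = 0 :> C.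
  by move=> d0 /dhomog_nemf_coeff; apply; rewrite /= mdeg0 eq_sym -lt0n.
(* The single twist is read off the entries x and y, of degree 1 over generators of degree [d2]; the
   entry z^n agrees with it because of [n_deg]. *)
exists [tuple (1 + (N + d2))%N], (\matrix_(i, j) g j), r,
  (\col_j partial j f).
split; first by rewrite /= d12 leqnn d1_gt0 d2_gt0.
- split=> i j m.
  + rewrite mxE => /(dhomog_mf (g_homog j)) /= ->; rewrite tnth_d.
    rewrite (tnth_nth 0%N) (ord1 (i : 'I_1)) /=.
    by case: ifP => _ //; rewrite addnCA n_deg addnS add1n.
  + by rewrite tnth_d; apply: r_homogN.
  + by rewrite mxE addn0; move=> /(dhomog_mf (homogeneous_partial i f_homog)).
- split=> i j; rewrite ?mxE.
  + by apply: homog_min (g_homog j); case: ifP.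
  + by apply: homog_min (r_homog i j); case: ifP.
  + apply: homog_min (homogeneous_partial _ f_homog).
    by rewrite -subn1 subn_gt0; apply: (leq_add d1_gt0 d2_gt0).
split.
- move=> u /rowP /(_ i1); rewrite !mxE big_ord_recl big_ord0 addr0 mxE => /eqP.
  have [_ -> _] := gE; rewrite mulf_eq0 (negbTE (mX_neq0 C i0)) orbF => /eqP u0.
  by apply/rowP => i; rewrite mxE (ord1 (i : 'I_1)).
- move=> v; split=> [/rowP vr|[u ->]].
    have [|t [t0 t1 t2]] := @relation_generated (v 0).
      by move=> j; have := vr j; rewrite !mxE.
    exists (const_mx t); apply/rowP => j.
    rewrite !mxE big_ord_recl big_ord0 addr0 !mxE.
    by case: (ord3P j) => ->.
  apply/rowP => j; rewrite !mxE big_ord3 /= !mxE !big_ord_recl !big_ord0 !addr0.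
  rewrite !mxE -!mulrA -!mulrDr; have [-> -> ->] := gE.
  by rewrite r_rel mulr0.
- move=> v; split=> [/rowP /(_ 0)|[u ->]].
    rewrite !mxE => vf; have [|u uE] := @syzygy_generated (v 0).
      by rewrite -[RHS]vf; apply: eq_bigr => j _; rewrite mxE.
    by exists (\row_i u i); apply/rowP => j; rewrite !mxE uE;
      apply: eq_bigr => i _; rewrite mxE.
  rewrite -mulmxA; suff -> : r *m (\col_j partial j f) = 0 by rewrite mulmx0.
  apply/matrixP => i j; rewrite !mxE -[RHS](syzygy_rows i).
  by apply: eq_bigr => k _; rewrite mxE.
- apply/seteqP; split=> h /= [u].
    move=> /matrixP /(_ 0 0); rewrite !mxE eqxx mulr1n => <-.
    by exists (u 0); apply: eq_bigr => j _; rewrite mxE.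
  move=> ->; exists (\row_i u i); apply/matrixP => i j.
  rewrite !ord1 !mxE eqxx mulr1n.
  by apply: eq_bigr => k _; rewrite !mxE.
Qed.

End NearlyFree.

(** * Quasi-homogeneity of the singularities *)

Section PolynomialMaps.
Variable C : numFieldType.

Lemma is_diff_eval n (P : mpoly n.+1 C) (a : 'rV[C]_n.+1) :
  is_diff a (eval P : 'rV[C]_n.+1 -> C)
    (fun v => \sum_k v 0 k * eval (mderiv k P) a).
Proof.
elim/mpoly_ring_ind: P => [c|i|p q pd qd|p q pd qd].
- have -> : eval (mpolyC n.+1 c) = cst c :> ('rV[C]_n.+1 -> C).
    by apply/funext => q; rewrite /eval mevalC.
  apply: is_diff_eq; apply/funext => v; rewrite big1 // => k _.
  by rewrite mderivC /eval meval0 mulr0.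
- have -> : eval 'X_i = (fun q => q 0 i) :> ('rV[C]_n.+1 -> C).
    by apply/funext => q; rewrite /eval mevalXU.
  have dX : differentiable (fun q : 'rV[C]_n.+1 => q 0 i) a.
    exact: differentiable_coord.
  apply: DiffDef => //; have @f : {linear 'rV[C]_n.+1 -> C}.
    by exists (fun N : 'rV[C]_n.+1 => N 0 i); do 2![eexists]; do ?[constructor];
      rewrite ?mxE// => ? *; rewrite ?mxE//; move=> ?; rewrite !mxE.
  rewrite (_ : (fun q : 'rV[C]_n.+1 => q 0 i) = f :> (_ -> _)) // diff_lin;
    last exact: coord_continuous.
  apply/funext => v; rewrite (bigD1 i) //= big1 => [|k /negbTE ki].
    rewrite addr0 mderivX mnm1E eqxx scale1r.
    have -> : mnm_sub (mnm1 i) (mnm1 i) = @mnm0 n.+1.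
      by apply/mnmP => k; rewrite mnmBE mnm0E subnn.
    by rewrite mpolyX0 /eval meval1 mulr1.
  by rewrite mderivX mnm1E eq_sym ki scale0r /eval meval0 mulr0.
- have -> : eval (p + q) = eval p \+ eval q :> ('rV[C]_n.+1 -> C).
    by apply/funext => v; rewrite /eval mevalD.
  apply: is_diff_eq; apply/funext => v /=; rewrite !fctE -big_split /=.
  by apply: eq_bigr => k _; rewrite mderivD /eval mevalD mulrDr.
- have -> : eval (p * q) = eval p * eval q :> ('rV[C]_n.+1 -> C).
    by apply/funext => v; rewrite /eval mevalM.
  apply: is_diff_eq; apply/funext => v.
  transitivity (eval p a * (\sum_k v 0 k * eval (mderiv k q) a) +
                eval q a * (\sum_k v 0 k * eval (mderiv k p) a)); first by [].
  rewrite !mulr_sumr -big_split; apply: eq_bigr => k _ /=.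
  by rewrite mderivM /eval mevalD !mevalM; ring.
Qed.

Lemma differentiable_eval n (P : mpoly n.+1 C) (a : 'rV[C]_n.+1) :
  differentiable (eval P : 'rV[C]_n.+1 -> C) a.
Proof. by have [] := is_diff_eval P a. Qed.

Definition poly_map (U : 'I_2 -> mpoly 2 C) (q : 'rV[C]_2) : 'rV[C]_2 :=
  \row_k eval (U k) q.

Let E (U : 'I_2 -> mpoly 2 C) (k : 'I_2) (q : 'rV[C]_2) : 'rV[C]_2 :=
  eval (U k) q *: delta_mx 0 k.

Lemma poly_mapE U : poly_map U = E U 0 + E U 1.
Proof.
apply/funext => q; apply/rowP => k; rewrite !mxE /=.
case: k => -[|[|//]] ltk /=; rewrite ?mulr1 ?mulr0 ?addr0 ?add0r;
  by congr (eval (U _) q); apply: val_inj.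
Qed.

Let is_diffE U k a : is_diff a (E U k)
  (fun v => (\sum_i v 0 i * eval (mderiv i (U k)) a) *: delta_mx 0 k).
Proof.
have [dU dUE] := is_diff_eval (U k) a.
apply: DiffDef; first exact: differentiableZl.
by apply: etrans (diffZl _ dU) _; rewrite dUE.
Qed.

Lemma is_diff_poly_map U a : is_diff a (poly_map U)
  (fun v => \row_k \sum_i v 0 i * eval (mderiv i (U k)) a).
Proof.
rewrite poly_mapE; apply: is_diff_eq (is_diffD (is_diffE U 0 a) (is_diffE U 1 a)) _.
apply/funext => v; apply/rowP => k; rewrite !mxE /=.
case: k => -[|[|//]] ltk /=; rewrite ?mulr1 ?mulr0 ?addr0 ?add0r;
  by apply: eq_bigr => i _; congr (_ * eval (mderiv _ (U _)) a); apply: val_inj.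
Qed.

Lemma differentiable_poly_map U a : differentiable (poly_map U) a.
Proof. by have [] := is_diff_poly_map U a. Qed.

Lemma jacobian_poly_map U a :
  jacobian (poly_map U) a = \matrix_(i, j) eval (mderiv i (U j)) a.
Proof.
rewrite /jacobian; have [_ ->] := is_diff_poly_map U a.
apply/matrixP => i j; rewrite !mxE (bigD1 i) //= big1 => [|k /negbTE ki].
  by rewrite mxE !eqxx mul1r addr0.
by rewrite mxE ki andbF mul0r.
Qed.

End PolynomialMaps.

Section Straightening.
Variable C : numFieldType.

Lemma eval_affine_chart (H : mpoly 3 C) i : exists P : mpoly 2 C,
  forall q, eval H (affine_chart i q) = eval P q.
Proof.
exists (comp_mpoly
  [tuple (if unlift i j is Some k then 'X_k else 1 : mpoly 2 C) | j < 3] H) => q.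
rewrite /eval comp_mpoly_meval; apply: meval_eq => j.
rewrite tnth_mktuple mxE; case: (unlift i j) => [k|]; first by rewrite mevalXU.
by rewrite meval1.
Qed.

(** The weights are all 1, [U] agrees with the translation q - a to first order, and the unit is H /
    D. Carrying the denominator [D] along turns the comparison of germs into an identity between
    polynomial values. *)
Lemma quasi_homogeneous_by (f : mpoly 3 C) p i (g : mpoly 2 C) N
    (U : 'I_2 -> mpoly 2 C) (D : mpoly 2 C) (H : mpoly 3 C) :
  let a := affine_coord i p in
  p 0 i != 0 -> homogeneous N g -> (forall k, eval (U k) a = 0) ->
  (forall j k, eval (mderiv j (U k)) a = (j == k)%:R) ->
  eval D a != 0 -> eval H (affine_chart i a) != 0 ->
  (forall q, eval f (affine_chart i q) * eval D q =
             eval H (affine_chart i q) * eval g (poly_map U q)) ->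
  quasi_homogeneous_at f p.
Proof.
move=> a pi gN Ua dUa Da Ha fE; exists i => //; rewrite -/a.
have [P PE] := eval_affine_chart H i.
have D_near : \forall q \near a, eval D q != 0.
  have Dc := differentiable_continuous (differentiable_eval D a).
  exact: (cvgr_neq0 (eval D a) Dc Da).
exists (fun=> 1%N), N, g, (poly_map U), (fun q => eval P q * (eval D q)^-1).
split=> //.
- move=> m /(dhomog_mf gN) /= <-; rewrite mdegE.
  by apply: eq_bigr => k _; rewrite mul1n.
- split.
  + by apply/rowP => k; rewrite !mxE Ua.
  + by apply: filterS D_near => q _; apply: differentiable_poly_map.
  + rewrite jacobian_poly_map; suff -> : \matrix_(j, k) eval (mderiv j (U k)) a = 1%:M.
      exact: unitmx1.
    by apply/matrixP => j k; rewrite !mxE dUa.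
- split; last by rewrite mulf_neq0 ?invr_neq0 // -PE.
  apply: filterS D_near => q Dq.
  apply: differentiableM; first exact: differentiable_eval.
  by apply: differentiableV => //; exact: differentiable_eval.
- apply: filterS D_near => q Dq; rewrite -PE.
  by rewrite mulrAC -fE mulfK.
Qed.

(** The hypothesis says that the quadratic form with coefficients [r00], [r01], [r11] vanishes at
    (t1, -t0), the zero of the linear form (t0, t1); the conclusion factors this linear form out. *)
Lemma binary_quadratic_dvd (t0 t1 r00 r01 r11 : C) : (t0 != 0) || (t1 != 0) ->
  r00 * t1 ^+ 2 - r01 * t0 * t1 + r11 * t0 ^+ 2 = 0 ->
  exists m0 m1, [/\ t0 * m0 = r00, t0 * m1 + t1 * m0 = r01 & t1 * m1 = r11].
Proof.
have [->|t0_neq0 _] := eqVneq t0 0 => /=.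
  move=> t1_neq0 /eqP; rewrite mulr0 mul0r expr0n mulr0 subr0 addr0 mulf_eq0.
  rewrite expf_eq0 (negbTE t1_neq0) orbF => /eqP ->.
  by exists (r01 / t1), (r11 / t1); split; rewrite ?mul0r ?add0r // mulrC divfK.
move=> rt; exists (r00 / t0), ((r01 - t1 * (r00 / t0)) / t0).
split; [by rewrite mulrC divfK|by rewrite mulrC divfK // subrK|].
have -> : r11 = (r01 * t0 * t1 - r00 * t1 ^+ 2) / t0 ^+ 2.
  apply: (mulIf (expf_neq0 2 t0_neq0)); rewrite divfK ?expf_neq0 //.
  by apply/eqP; rewrite -subr_eq0 -rt; apply/eqP; ring.
by field.
Qed.

End Straightening.

Section Germs.
Variable C : numFieldType.
Local Notation dot b p := (\sum_j b 0 j * p 0 j).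

Definition conic0 : mpoly 3 C := 'X_i0 * 'X_i1 - 'X_i2 ^+ 2.

Definition conic_grad (p : 'rV[C]_3) : 'rV[C]_3 :=
  \row_j match val j with 0%N => p 0 i1 | 1%N => p 0 i0 | _ => - (p 0 i2 *+ 2) end.

Lemma partial_conic0 j : partial j conic0 =
  match val j with 0%N => 'X_i1 | 1%N => 'X_i0 | _ => - ('X_i2 *+ 2) end.
Proof.
rewrite /partial /conic0 mderivB expr2 !mderivM !X_linform.
rewrite ![mderiv _ _]partial_linform !mxE !eqxx /=.
by case: (ord3P j) => -> /=; rewrite !(mpolyC0, mpolyC1); ring.
Qed.

Lemma eval_conic0 p : eval conic0 p = p 0 i0 * p 0 i1 - p 0 i2 ^+ 2.
Proof. by rewrite /eval /conic0 mevalB mevalM expr2 mevalM !mevalXU expr2. Qed.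

Lemma eval_partial_conic0 p j : eval (partial j conic0) p = conic_grad p 0 j.
Proof.
rewrite partial_conic0 mxE /eval.
by case: (ord3P j) => -> /=; rewrite ?mevalN ?mevalMn mevalXU.
Qed.

Lemma eval_prod n (I : Type) (r : seq I) (P : pred I) (F : I -> mpoly n C) q :
  eval (\prod_(i <- r | P i) F i) q = \prod_(i <- r | P i) eval (F i) q.
Proof. exact: rmorph_prod. Qed.

Lemma evalM n (F G : mpoly n C) q : eval (F * G) q = eval F q * eval G q.
Proof. exact: mevalM. Qed.

Lemma evalD n (F G : mpoly n C) q : eval (F + G) q = eval F q + eval G q.
Proof. exact: mevalD. Qed.

Lemma evalZ n c (F : mpoly n C) q : eval (c *: F) q = c * eval F q.
Proof. exact: mevalZ. Qed.

Lemma big_ord2 (R : nmodType) (F : 'I_2 -> R) : \sum_k F k = F 0 + F 1.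
Proof.
by rewrite !big_ord_recl big_ord0 addr0; congr (F _ + F _); apply: val_inj.
Qed.

Section Chart.
Variables (p : 'rV[C]_3) (i : 'I_3).
Hypothesis pi : p 0 i != 0.
Let a := affine_coord i p.

Lemma affine_chart_self q : affine_chart i q 0 i = 1 :> C.
Proof. by rewrite mxE unlift_none. Qed.

Lemma affine_chart_lift q k : affine_chart i q 0 (lift i k) = q 0 k :> C.
Proof. by rewrite mxE liftK. Qed.

Lemma affine_chart_coord : affine_chart i a = (p 0 i)^-1 *: p.
Proof.
apply/rowP => j; rewrite [RHS]mxE; case: (unliftP i j) => [k|] ->.
  by rewrite affine_chart_lift mxE mulrC.
by rewrite affine_chart_self mulVf.
Qed.

Lemma eval_line_chart (b : 'rV[C]_3) (q : 'rV[C]_2) : dot b p = 0 ->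
  eval (linform b) (affine_chart i q) =
  b 0 (lift i 0) * (q 0 0 - a 0 0) + b 0 (lift i 1) * (q 0 1 - a 0 1).
Proof.
move=> bp; have ap k : p 0 (lift i k) = a 0 k * p 0 i by rewrite mxE divfK.
have bi : b 0 i = - (b 0 (lift i 0) * a 0 0 + b 0 (lift i 1) * a 0 1).
  apply: (mulIf pi); apply/eqP; rewrite -subr_eq0; apply/eqP.
  by rewrite -[RHS]bp (bigD1_ord i) //= big_ord2 !ap; ring.
rewrite eval_linform (bigD1_ord i) //= big_ord2 affine_chart_self.
by rewrite !affine_chart_lift bi; ring.
Qed.

Lemma lift3 : [\/ [/\ i = i0, lift i 0 = i1 & lift i 1 = i2],
  [/\ i = i1, lift i 0 = i0 & lift i 1 = i2] |
  [/\ i = i2, lift i 0 = i0 & lift i 1 = i1]].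
Proof.
by case: (ord3P i) => ->; [apply: Or31|apply: Or32|apply: Or33];
  split=> //; apply: val_inj.
Qed.

(** This is the Taylor expansion at [a], exact in degree 2. The gradient is linear in p, so that
    dividing by [p 0 i] gives its value at the chart point; the quadratic part is -z^2 in the charts
    x = 1 and y = 1, and xy in the chart z = 1. *)
Lemma eval_conic_chart : eval conic0 p = 0 -> exists r00 r01 r11, forall q : 'rV[C]_2,
  let v k := q 0 k - a 0 k in
  eval conic0 (affine_chart i q) =
  conic_grad p 0 (lift i 0) / p 0 i * v 0 + conic_grad p 0 (lift i 1) / p 0 i * v 1
  + (r00 * v 0 ^+ 2 + r01 * v 0 * v 1 + r11 * v 1 ^+ 2).
Proof.
move=> pc.
have gradE j : conic_grad p 0 j / p 0 i = conic_grad (affine_chart i a) 0 j.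
  by rewrite affine_chart_coord !mxE; case: (ord3P j) => -> /=; ring.
have ca : eval conic0 (affine_chart i a) = 0.
  have := pc; rewrite affine_chart_coord !eval_conic0 !mxE exprMn => pc'.
  by rewrite mulrACA -expr2 -mulrBr pc' mulr0.
rewrite !gradE; move: ca.
have := affine_chart_lift; have := affine_chart_self.
have chart q := eval_conic0 (affine_chart i q).
case: lift3 => -[iE l0E l1E] self lft ca.
- exists 0, 0, (-1) => q v; rewrite -[LHS]subr0 -[in LHS]ca !chart.
  rewrite ![conic_grad _ _ _]mxE l0E l1E /= -iE !self.
  by rewrite -l0E -l1E !lft /v; ring.
- exists 0, 0, (-1) => q v; rewrite -[LHS]subr0 -[in LHS]ca !chart.
  rewrite ![conic_grad _ _ _]mxE l0E l1E /= -iE !self.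
  by rewrite -l0E -l1E !lft /v; ring.
- exists 0, 1, 0 => q v; rewrite -[LHS]subr0 -[in LHS]ca !chart.
  rewrite ![conic_grad _ _ _]mxE l0E l1E /= -iE !self.
  by rewrite -l0E -l1E !lft /v; ring.
Qed.

End Chart.

End Germs.
Arguments conic0 {C}.

Section QuasiHomogeneous.
Variables (C : numFieldType) (p : 'rV[C]_3) (i : 'I_3).
Hypothesis pi : p 0 i != 0.
Let a := affine_coord i p.
Local Notation dot b p := (\sum_j b 0 j * p 0 j).

(* The linear part at a of the linear form b in the chart p_i != 0 *)
Definition lin2 (b : 'rV[C]_3) : mpoly 2 C :=
  b 0 (lift i 0) *: 'X_0 + b 0 (lift i 1) *: 'X_1.

Lemma eval_lin2 b (q : 'rV[C]_2) :
  eval (lin2 b) q = b 0 (lift i 0) * q 0 0 + b 0 (lift i 1) * q 0 1.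
Proof. by rewrite /lin2 evalD !evalZ /eval !mevalXU. Qed.

Lemma homogeneous_lin2 b : homogeneous 1 (lin2 b).
Proof. by apply: rpredD; apply: rpredZ; rewrite dhomogX /= mdeg1. Qed.

Lemma homogeneous_prod_lin2 (I : finType) (P : pred I) (F : I -> 'rV[C]_3) :
  homogeneous (\sum_(j | P j) 1)%N (\prod_(j | P j) lin2 (F j)).
Proof.
apply: (big_ind2 (fun d (p : mpoly 2 C) => homogeneous d p)) => [|d q e r|j _].
- exact: dhomog1.
- exact: dhomogM.
- exact: homogeneous_lin2.
Qed.

Lemma mderivX2 j k : mderiv j ('X_k : mpoly 2 C) = (j == k)%:R.
Proof.
rewrite mderivX mnm1E eq_sym; case: eqVneq => [->|_]; last by rewrite scale0r.
rewrite scale1r; have -> : mnm_sub (mnm1 k) (mnm1 k) = @mnm0 2.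
  by apply/mnmP => s; rewrite mnmBE mnm0E subnn.
exact: mpolyX0.
Qed.

Let V (k : 'I_2) : mpoly 2 C := 'X_k - mpolyC 2 (a 0 k).

Let eval_V k q : eval (V k) q = q 0 k - a 0 k.
Proof. by rewrite /V /eval mevalB mevalXU mevalC. Qed.

Let mderivV j k : mderiv j (V k) = (j == k)%:R.
Proof. by rewrite /V mderivB mderivC subr0 mderivX2. Qed.

Section Lines.
Variables (m : nat) (l : 'I_m -> 'rV[C]_3).
Local Notation through j := (dot (l j) p == 0).

Lemma eval_prod_off_neq0 :
  eval (\prod_(j | ~~ through j) linform (l j)) (affine_chart i a) != 0.
Proof.
rewrite eval_prod; apply/prodf_neq0 => j lp.
rewrite eval_linform affine_chart_coord //.
under eq_bigr do rewrite mxE mulrCA.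
by rewrite -mulr_sumr mulf_neq0 // invr_neq0.
Qed.

Lemma quasi_homogeneous_off_conic : eval conic0 p != 0 ->
  quasi_homogeneous_at ((\prod_j linform (l j)) * conic0) p.
Proof.
move=> pc; apply: (quasi_homogeneous_by (U := V) (D := 1) (i := i)
  (g := \prod_(j | through j) lin2 (l j))
  (H := (\prod_(j | ~~ through j) linform (l j)) * conic0)) => //.
- exact: homogeneous_prod_lin2.
- by move=> k; rewrite eval_V subrr.
- by move=> j k; rewrite mderivV /eval rmorph_nat.
- by rewrite /eval meval1 oner_neq0.
- rewrite evalM mulf_neq0 ?eval_prod_off_neq0 // affine_chart_coord //.
  rewrite eval_conic0 !mxE exprMn mulrACA -expr2 -mulrBr mulf_neq0 //.
    by rewrite expf_neq0 // invr_neq0.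
  by rewrite -eval_conic0.
move=> q; rewrite !evalM /eval meval1 mulr1 -!/(eval _ _).
rewrite mulrAC; congr (_ * _); rewrite !eval_prod (bigID (fun j => through j)) /=.
rewrite mulrC; congr (_ * _); apply: eq_bigr => j /eqP lp.
by rewrite eval_lin2 !mxE !eval_V (eval_line_chart pi).
Qed.

(* With v = q - a and w in the kernel of b2, the change of coordinates
   u = v (1 + m(v)) + s b1(v) b3(v) w multiplies each b_k(v) by a unit,
   and m, s are chosen so that the equation of the conic is linear in u *)
Lemma quasi_homogeneous_on_conic (b1 b2 b3 : 'rV[C]_3) : eval conic0 p = 0 ->
  (forall b, b \in [:: b1; b2; b3] -> dot b p = 0 /\
     exists k, cross (conic_grad p 0) (b 0) k != 0) ->
  (forall j, dot (l j) p = 0 -> l j \in [:: b1; b2; b3]) ->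
  quasi_homogeneous_at ((\prod_j linform (l j)) * conic0) p.
Proof.
move=> pc bP lb; have [r00 [r01 [r11 cE]]] := eval_conic_chart pi pc.
move: cE; set t0 := _ / p 0 i; set t1 := _ / p 0 i => cE.
pose e (b : 'rV[C]_3) := t0 * b 0 (lift i 1) - t1 * b 0 (lift i 0).
(* The conic gradient and [b] both annihilate p, so their cross product is proportional to p and is
   nonzero at [i] once it is nonzero anywhere. That entry is, up to sign, [e b * p 0 i]. *)
have e_neq0 b : b \in [:: b1; b2; b3] -> e b != 0.
  case/bP=> bp [k]; apply: contra_neq => eb0.
  have w_p j : cross (conic_grad p 0) (b 0) j * p 0 i =
               cross (conic_grad p 0) (b 0) i * p 0 j.
    apply: cross_eq0 => {}j; rewrite cross_cross bp mulr0 subr0.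
    suff -> : dot (conic_grad p) p = 0 by rewrite mulr0.
    rewrite big_ord3 /= !mxE /=; transitivity (2 * eval conic0 p).
      by rewrite eval_conic0; ring.
    by rewrite pc mulr0.
  apply: (mulIf pi); rewrite w_p mul0r; suff -> : cross (conic_grad p 0) (b 0) i = 0.
    by rewrite mul0r.
  have : e b * p 0 i = 0 by rewrite eb0 mul0r.
  rewrite /e mulrBl [t0 * _ * _]mulrAC [t1 * _ * _]mulrAC /t0 /t1 !divfK //.
  rewrite /cross; case: (lift3 i) => -[-> -> ->] //=.
  by move=> /(congr1 -%R); rewrite opprB oppr0.
have {e_neq0}[e1 e2 e3] : [/\ e b1 != 0, e b2 != 0 & e b3 != 0].
  by split; apply: e_neq0; rewrite !inE eqxx ?orbT.
have t_neq0 : (t0 != 0) || (t1 != 0).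
  by move: e1; rewrite /e; have [->|//] := eqVneq t0 0; have [->|//] := eqVneq t1 0;
    rewrite !mul0r subrr eqxx.
(* On the tangent direction (t1, -t0) of the conic, b1 b3 takes the value [e b1 * e b3]. With this
   [sigma], the quadratic part minus sigma b1 b3 vanishes there, so the tangent form divides it,
   with quotient m = (m0, m1). *)
pose sigma := (r00 * t1 ^+ 2 - r01 * t0 * t1 + r11 * t0 ^+ 2) / (e b1 * e b3).
have [|m0 [m1 [m00 m01 m11]]] := @binary_quadratic_dvd C t0 t1
  (r00 - sigma * b1 0 (lift i 0) * b3 0 (lift i 0))
  (r01 - sigma * (b1 0 (lift i 0) * b3 0 (lift i 1) +
                  b1 0 (lift i 1) * b3 0 (lift i 0)))
  (r11 - sigma * b1 0 (lift i 1) * b3 0 (lift i 1)) t_neq0.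
  transitivity (r00 * t1 ^+ 2 - r01 * t0 * t1 + r11 * t0 ^+ 2 -
                sigma * (e b1 * e b3)); first by rewrite /e; ring.
  by rewrite /sigma divfK ?subrr // mulf_neq0.
(* The tangent form takes the value - [e b2] on [w], so this [s] makes the correction along [w]
   contribute exactly sigma b1 b3 to the equation of the conic. *)
pose s := - sigma / e b2.
pose w (k : 'I_2) := if k == 0 then - b2 0 (lift i 1) else b2 0 (lift i 0).
pose bw (b : 'rV[C]_3) := b 0 (lift i 0) * w 0 + b 0 (lift i 1) * w 1.
pose A (b : 'rV[C]_3) := b 0 (lift i 0) *: V 0 + b 0 (lift i 1) *: V 1.
have eval_A b q : eval (A b) q =
    b 0 (lift i 0) * (q 0 0 - a 0 0) + b 0 (lift i 1) * (q 0 1 - a 0 1).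
  by rewrite /A evalD !evalZ !eval_V.
have eval_Aa b : eval (A b) a = 0 by rewrite eval_A !subrr !mulr0 addr0.
pose M := m0 *: V 0 + m1 *: V 1.
have eval_M q : eval M q = m0 * (q 0 0 - a 0 0) + m1 * (q 0 1 - a 0 1).
  by rewrite /M evalD !evalZ !eval_V.
have eval_Ma : eval M a = 0 by rewrite eval_M !subrr !mulr0 addr0.
clearbody A M.
have eval1 n q : eval (1 : mpoly n C) q = 1 by rewrite /eval meval1.
pose U k := V k * (1 + M) + (s * w k) *: (A b1 * A b3).
have eval_U k q : eval (U k) q = (q 0 k - a 0 k) * (1 + eval M q) +
    s * w k * (eval (A b1) q * eval (A b3) q).
  by rewrite /U evalD evalM eval_V evalD eval1 evalZ evalM.
(* The correction s b1 b3 w has both b1 and b3 as factors, and b2 kills [w]; hence each of the three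
   forms still divides its image. *)
have lin_U b : b \in [:: b1; b2; b3] -> exists E : mpoly 2 C, eval E a = 1 /\
    forall q, eval (lin2 b) (poly_map U q) = eval (A b) q * eval E q.
  have uE q : eval (lin2 b) (poly_map U q) = eval (A b) q * (1 + eval M q) +
      s * bw b * (eval (A b1) q * eval (A b3) q).
    by rewrite eval_lin2 !mxE !eval_U [eval (A b) q]eval_A /bw; ring.
  rewrite !inE => /or3P[] /eqP bE.
  - exists (1 + M + (s * bw b) *: A b3); split=> [|q].
      by rewrite !evalD evalZ eval1 eval_Ma eval_Aa; ring.
    by rewrite uE !evalD evalZ eval1 -bE; ring.
  - exists (1 + M); split=> [|q]; first by rewrite evalD eval1 eval_Ma addr0.
    have bw0 : bw b = 0 by rewrite /bw /w bE /=; ring.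
    by rewrite uE evalD eval1 bw0 mulr0 mul0r addr0.
  - exists (1 + M + (s * bw b) *: A b1); split=> [|q].
      by rewrite !evalD evalZ eval1 eval_Ma eval_Aa; ring.
    by rewrite uE !evalD evalZ eval1 -bE; ring.
have conic_U q : t0 * eval (U 0) q + t1 * eval (U 1) q =
    eval conic0 (affine_chart i q).
  have sw : s * (t0 * w 0 + t1 * w 1) = sigma.
    have -> : t0 * w 0 + t1 * w 1 = - e b2 by rewrite /e /w /=; ring.
    by rewrite /s mulrN divfK // opprK.
  rewrite cE !eval_U !eval_A eval_M -/a.
  set v0 := q 0 0 - a 0 0; set v1 := q 0 1 - a 0 1.
  transitivity (t0 * v0 + t1 * v1 + (t0 * m0 * v0 ^+ 2 +
    (t0 * m1 + t1 * m0) * v0 * v1 + t1 * m1 * v1 ^+ 2) +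
    s * (t0 * w 0 + t1 * w 1) *
    ((b1 0 (lift i 0) * v0 + b1 0 (lift i 1) * v1) *
     (b3 0 (lift i 0) * v0 + b3 0 (lift i 1) * v1))); first by ring.
  by rewrite sw m00 m01 m11; ring.
have /boolp.choice[E EP] j : exists E, eval E a = 1 /\ (through j -> forall q,
    eval (lin2 (l j)) (poly_map U q) = eval (A (l j)) q * eval E q).
  have [lp|_] := boolP (through j); last by exists 1; rewrite eval1.
  by have [E [Ea EE]] := lin_U _ (lb _ (eqP lp)); exists E.
apply: (quasi_homogeneous_by (U := U) (i := i)
  (D := \prod_(j | through j) E j)
  (g := (t0 *: 'X_0 + t1 *: 'X_1) * \prod_(j | through j) lin2 (l j))
  (H := \prod_(j | ~~ through j) linform (l j))) => //.
- apply: dhomogM (homogeneous_prod_lin2 _ _).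
  by apply: rpredD; apply: rpredZ; rewrite dhomogX /= mdeg1.
- by move=> k; rewrite eval_U !eval_Aa subrr; ring.
- move=> j k; rewrite /U mderivD mderivM mderivZ mderivM mderivV.
  rewrite evalD [eval (_ + V k * _) a]evalD [eval (V k * _) a]evalM eval_V subrr.
  rewrite mul0r evalM evalD eval1 eval_Ma evalZ evalD !evalM !eval_Aa.
  by rewrite /eval rmorph_nat; ring.
- rewrite eval_prod; apply/prodf_neq0 => j _.
  by have [-> _] := EP j; rewrite oner_neq0.
- exact: eval_prod_off_neq0.
move=> q; rewrite !evalM [eval (t0 *: _ + _) _]evalD !evalZ.
rewrite [eval 'X_0 _]mevalXU [eval 'X_1 _]mevalXU.
rewrite ![poly_map U q 0 _]mxE conic_U !eval_prod (bigID (fun j => through j)) /=.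
have -> : \prod_(j | through j) eval (lin2 (l j)) (poly_map U q) =
    \prod_(j | through j) eval (linform (l j)) (affine_chart i q) *
    \prod_(j | through j) eval (E j) q.
  rewrite -big_split; apply: eq_bigr => j lp /=.
  have [_ ->] := EP j => //.
  by rewrite eval_A (eval_line_chart pi) // (eqP lp).
by ring.
Qed.

End Lines.
End QuasiHomogeneous.

(** * Intersection points of lines and a conic *)

Lemma card_eq_seq (T : eqType) (s : seq T) : uniq s -> ([set` s] #= `I_(size s))%card.
Proof.
elim: s => [_|x s IHs /= /andP[xs us]].
  by rewrite /= II0 (_ : [set` [::]] = set0)%classic ?card_eqxx // -subset0 => y.
apply/eq_cardSP; exists x; first by rewrite /= mem_head.
suff -> : ([set` x :: s] `\ x = [set` s])%classic by apply: IHs.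
apply/seteqP; split=> y /=; rewrite inE.
  by case=> /orP[/eqP //|].
by move=> ys; split; [rewrite ys orbT|move=> yx; rewrite -yx ys in xs].
Qed.

Definition ivec : Type := int * int * int.

Definition icross (a b : ivec) : ivec :=
  (a.1.2 * b.2 - a.2 * b.1.2, a.2 * b.1.1 - a.1.1 * b.2,
   a.1.1 * b.1.2 - a.1.2 * b.1.1).

Definition idot (a b : ivec) : int := a.1.1 * b.1.1 + a.1.2 * b.1.2 + a.2 * b.2.

Definition iconic (a : ivec) : int := a.1.1 * a.1.2 - a.2 ^+ 2.

Definition igrad (a : ivec) : ivec := (a.1.2, a.1.1, - (a.2 *+ 2)).

(* The point of parameter (s : t) on the conic xy = z^2, and the chord joining
   two such points *)
Definition conic_point (s : int * int) : ivec := (s.1 ^+ 2, s.2 ^+ 2, s.1 * s.2).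

Definition chord (c : (int * int) * (int * int)) : ivec :=
  let: ((a1, b1), (a2, b2)) := c in (b1 * b2, a1 * a2, - (a1 * b2 + a2 * b1)).

Section IntegerVectors.
Variable C : numFieldType.
Local Notation dot b p := (\sum_j b 0 j * p 0 j).

Definition vec (a : ivec) : 'rV[C]_3 :=
  \row_j (match val j with 0%N => a.1.1 | 1%N => a.1.2 | _ => a.2 end)%:~R.

Lemma vec_eq0 a : (vec a == 0) = (a == (0, 0, 0)).
Proof.
case: a => -[a0 a1] a2; apply/eqP/eqP => [/rowP v0|[-> -> ->]]; last first.
  by apply/rowP => j; rewrite !mxE; case: (val j) => [|[]].
have := v0 i0; have := v0 i1; have := v0 i2; rewrite !mxE /=.
by do 3![move=> /eqP; rewrite intr_eq0 => /eqP ->].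
Qed.

Lemma vec_cross a b k : cross (vec a 0) (vec b 0) k = vec (icross a b) 0 k.
Proof.
by rewrite /cross !mxE; case: (ord3P k) => -> /=; rewrite rmorphB !rmorphM.
Qed.

Lemma cross_vec_neq0 a b : icross a b != (0, 0, 0) ->
  exists k, cross (vec a 0) (vec b 0) k != 0.
Proof.
by rewrite -vec_eq0 => /rV0Pn[k ck]; exists k; rewrite vec_cross.
Qed.

Lemma vec_dot a b : dot (vec a) (vec b) = (idot a b)%:~R.
Proof. by rewrite big_ord3 /= !mxE /= !rmorphD !rmorphM. Qed.

Lemma eval_conic_vec a : eval conic0 (vec a) = (iconic a)%:~R.
Proof. by rewrite eval_conic0 !mxE /= rmorphB rmorphM rmorphXn. Qed.

Lemma conic_grad_vec a : conic_grad (vec a) = vec (igrad a).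
Proof.
apply/rowP => j; rewrite !mxE.
by case: (ord3P j) => -> /=; rewrite ?rmorphN ?rmorphMn.
Qed.

Lemma conic_gradZ (c : C) p : conic_grad (c *: p) = c *: conic_grad p.
Proof.
apply/rowP => j; rewrite !mxE.
by case: (ord3P j) => -> /=; rewrite ?mxE //; ring.
Qed.

Lemma eval_linformZ b (c : C) p : eval (linform b) (c *: p) = c * eval (linform b) p.
Proof.
rewrite !eval_linform mulr_sumr; apply: eq_bigr => j _; rewrite mxE; ring.
Qed.

Lemma eval_conicZ (c : C) p : eval conic0 (c *: p) = c ^+ 2 * eval conic0 p.
Proof. by rewrite !eval_conic0 !mxE; ring. Qed.

Lemma proportional (p q : 'rV[C]_3) : p != 0 -> q != 0 ->
  (forall k, cross (p 0) (q 0) k = 0) -> exists2 c, c != 0 & p = c *: q.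
Proof.
move=> p0 /rV0Pn[j qj] /cross_eq0 pq; have pE : p = (p 0 j / q 0 j) *: q.
  by apply/rowP => k; rewrite mxE mulrAC -pq mulfK.
exists (p 0 j / q 0 j) => //; apply: contra_neq p0 => c0.
by rewrite pE c0 scale0r.
Qed.

(** The witness is the cross product of [a] with the k-th basis vector: its product with any u is
    minus the k-th entry of a x u. *)
Lemma line_witness (a b : 'rV[C]_3) k : cross (a 0) (b 0) k != 0 ->
  exists2 v : 'rV[C]_3, dot a v = 0 & dot b v != 0.
Proof.
move=> abk; have triple (u : 'rV[C]_3) :
    dot u (\row_j cross (a 0) ((delta_mx 0 k : 'rV[C]_3) 0) j) =
    - cross (a 0) (u 0) k.
  rewrite big_ord3 /= !mxE /cross /= !mxE eqxx /=.
  by case: (ord3P k) => -> /=; ring.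
exists (\row_j cross (a 0) ((delta_mx 0 k : 'rV[C]_3) 0) j).
  by rewrite triple /cross; case: (ord3P k) => -> /=; ring.
by rewrite triple oppr_eq0.
Qed.

Lemma conic_smooth (p : 'rV[C]_3) : p != 0 -> conic_grad p != 0.
Proof.
apply: contra_neq => /rowP g0; apply/rowP => j; rewrite mxE.
have := g0 i0; have := g0 i1; have := g0 i2; rewrite !mxE /= => /eqP.
by rewrite oppr_eq0 mulrn_eq0 /= => /eqP ? ? ?; case: (ord3P j) => ->.
Qed.

(** Where X is nonzero, a point (X : Y : Z) of the conic has parameter (X : Z), and the last
    hypothesis compares (a : b) with it. *)
Lemma cross_conic_point (p : 'rV[C]_3) (a b : int) : p 0 i0 != 0 ->
  eval conic0 p = 0 -> b%:~R * p 0 i0 = a%:~R * p 0 i2 ->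
  forall k, cross (p 0) (vec (conic_point (a, b)) 0) k = 0.
Proof.
rewrite eval_conic0 => X_neq0 pc pab k; apply: (mulfI X_neq0); rewrite mulr0.
rewrite /cross !mxE; case: (ord3P k) => -> /=; rewrite !(rmorphXn, rmorphM) /=.
- transitivity (a%:~R * b%:~R * (p 0 i0 * p 0 i1 - p 0 i2 ^+ 2) -
    p 0 i2 * b%:~R * (b%:~R * p 0 i0 - a%:~R * p 0 i2)); first by ring.
  by rewrite pc pab subrr !mulr0 subrr.
- transitivity (- p 0 i0 * a%:~R * (b%:~R * p 0 i0 - a%:~R * p 0 i2)).
    by ring.
  by rewrite pab subrr mulr0.
- transitivity ((b%:~R * p 0 i0 - a%:~R * p 0 i2) *
    (b%:~R * p 0 i0 + a%:~R * p 0 i2) -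
    a%:~R ^+ 2 * (p 0 i0 * p 0 i1 - p 0 i2 ^+ 2)); first by ring.
  by rewrite pc pab subrr mul0r mulr0 subrr.
Qed.

(** Modulo the conic, X times the equation of the chord is (b1 X - a1 Z)(b2 X - a2 Z). If X = 0, the
    point is (0 : 1 : 0) and the equation reduces to a1 a2 = 0. *)
Lemma conic_chord (a1 b1 a2 b2 : int) (p : 'rV[C]_3) : p != 0 ->
  eval conic0 p = 0 -> dot (vec (chord ((a1, b1), (a2, b2)))) p = 0 ->
  (forall k, cross (p 0) (vec (conic_point (a1, b1)) 0) k = 0) \/
  (forall k, cross (p 0) (vec (conic_point (a2, b2)) 0) k = 0).
Proof.
move=> p_neq0 pc; rewrite big_ord3 /= !mxE /= !(rmorphD, rmorphN, rmorphM) /= => l0.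
have := pc; rewrite eval_conic0 => XYZ.
have [X0|X_neq0] := eqVneq (p 0 i0) 0.
  have Z0 : p 0 i2 = 0.
    by move: XYZ; rewrite X0 mul0r sub0r => /eqP; rewrite oppr_eq0 expf_eq0 => /eqP.
  have Y_neq0 : p 0 i1 != 0.
    apply: contra_neq p_neq0 => Y0; apply/rowP => j; rewrite mxE.
    by case: (ord3P j) => ->.
  move: l0; rewrite X0 Z0 !mulr0 add0r addr0 => /eqP.
  rewrite mulf_eq0 (negbTE Y_neq0) orbF mulf_eq0 => /orP[] /eqP A0; [left|right];
    by move=> k; rewrite /cross !mxE; case: (ord3P k) => -> /=;
      rewrite !(rmorphXn, rmorphM) /= ?A0 ?X0 ?Z0; ring.
have /eqP : (b1%:~R * p 0 i0 - a1%:~R * p 0 i2) *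
            (b2%:~R * p 0 i0 - a2%:~R * p 0 i2) = 0.
  move: XYZ l0; move: (p 0 i0) (p 0 i1) (p 0 i2) => X Y Z XYZ l0.
  transitivity (X * (b1%:~R * b2%:~R * X + a1%:~R * a2%:~R * Y -
      (a1%:~R * b2%:~R + a2%:~R * b1%:~R) * Z)
      - a1%:~R * a2%:~R * (X * Y - Z ^+ 2)); first by ring.
  by rewrite XYZ -mulNr l0 !mulr0 subrr.
by rewrite mulf_eq0 => /orP[] /eqP /subr0_eq; [left|right];
  apply: cross_conic_point.
Qed.

End IntegerVectors.

Definition izero : ivec := (0, 0, 0).

Definition parallel (a b : ivec) : bool :=
  [&& a != izero, b != izero & icross a b == izero].

Definition through (ls : seq ivec) (t : ivec) : seq ivec :=
  [seq l <- ls | idot l t == 0].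

Definition imult (ls : seq ivec) (t : ivec) : nat :=
  size (through ls t) + (iconic t == 0%R).

(* pts lists, up to proportionality, the points where two components meet.
   A line and the conic meet at the end points of the chord, so that these
   need not be computed. *)
Definition configuration (s : seq ((int * int) * (int * int)))
    (ls pts : seq ivec) : bool :=
  [&& ls == map chord s,
      all (fun c => c.1.1 * c.2.2 - c.2.1 * c.1.2 != 0) s,
      all (fun l => l != izero) ls,
      pairwise (fun a b => (icross a b != izero) &&
                           has (parallel (icross a b)) pts) ls,
      all (fun c => has (parallel (conic_point c.1)) pts &&
                    has (parallel (conic_point c.2)) pts) s,
      all (fun t => t != izero) pts,
      pairwise (fun a b => icross a b != izero) pts,
      all (fun t => (1 < imult ls t <= 4)%N) pts &
      all (fun t => (iconic t == 0) ==>
             all (fun l => icross (igrad t) l != izero) (through ls t)) pts].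

(** * The arrangement of a configuration: incidences and singularities *)

Section Arrangement.
Variables (C : numFieldType) (s : seq ((int * int) * (int * int))).
Variables (ls pts : seq ivec).
Hypothesis conf : configuration s ls pts.
Hypothesis ls_gt0 : (0 < size ls)%N.
Local Notation dot b p := (\sum_j b 0 j * p 0 j).
Local Notation L i := (nth izero ls i).

Definition line_vec (i : 'I_(size ls)) : 'rV[C]_3 := vec C (L i).

Let lsE : ls = map chord s.
Proof. by case/and5P: conf => /eqP. Qed.

Lemma line_vec_neq0 i : line_vec i != 0.
Proof.
rewrite vec_eq0; case/and5P: conf => _ _ /allP ls0 _ _.
by apply: ls0; apply: mem_nth.
Qed.

Lemma icross_eq0C a b : (icross a b == izero) = (icross b a == izero).
Proof.
suff imp u v : icross u v = izero -> icross v u = izero.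
  by apply/eqP/eqP; apply: imp.
case: u v => [[u0 u1] u2] [[v0 v1] v2] [/= e0 e1 e2]; congr (_, _, _) => /=.
- by rewrite -[LHS]opprK opprB mulrC [v1 * u2]mulrC e0 oppr0.
- by rewrite -[LHS]opprK opprB mulrC [v2 * u0]mulrC e1 oppr0.
- by rewrite -[LHS]opprK opprB mulrC [v0 * u1]mulrC e2 oppr0.
Qed.

(** The check by [pairwise] covers only i < j, whence the two orientations of the cross product. *)
Lemma lines_meet (i j : 'I_(size ls)) : i != j ->
  (icross (L i) (L j) != izero) /\
  exists2 t, t \in pts & parallel (icross (L i) (L j)) t \/
                         parallel (icross (L j) (L i)) t.
Proof.
case/and5P: conf => _ _ _ /(pairwiseP izero) lsP _.
wlog ij : i j / (i < j)%N => [IH|_] ; last first.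
  have /andP[-> /hasP[t tpts par]] := lsP i j (ltn_ord i) (ltn_ord j) ij.
  by split=> //; exists t => //; left.
rewrite neq_ltn => /orP[] ij; first by apply: IH => //; rewrite neq_ltn ij.
have [|c0 [t tpts par]] := IH j i ij; first by rewrite neq_ltn ij.
split; first by rewrite icross_eq0C.
by exists t => //; case: par; [right|left].
Qed.

Lemma line_vec_cross i j : i != j -> exists k, cross (line_vec i 0) (line_vec j 0) k != 0.
Proof. by case/lines_meet => c0 _; apply: cross_vec_neq0. Qed.

Lemma is_line_line_vec i : is_line (linform (line_vec i)).
Proof. by split; [rewrite linform_eq0 line_vec_neq0|apply: homogeneous_linform]. Qed.

Lemma homogeneous_conic0 : homogeneous 2 (conic0 : mpoly 3 C).
Proof.
apply: rpredB; last by apply: (@dhomogMn _ _ _ 1); rewrite dhomogX /= mdeg1.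
by apply: (@dhomogM _ _ _ 1 _ 1); rewrite dhomogX /= mdeg1.
Qed.

Lemma is_smooth_conic0 : is_smooth_conic (conic0 : mpoly 3 C).
Proof.
split=> [||p [p0 _ dp]]; last 1 first.
- have /eqP[] := conic_smooth p0.
  by apply/rowP => j; rewrite -eval_partial_conic0 dp mxE.
- apply/eqP => /(congr1 (fun f => eval f (vec C (0, 0, 1)))).
  rewrite eval_conic_vec /eval meval0 => /eqP.
  by rewrite intr_eq0.
- exact: homogeneous_conic0.
Qed.

Lemma line_vec_distinct i j : i != j ->
  ~ same_curve (linform (line_vec i)) (linform (line_vec j)).
Proof.
rewrite eq_sym => /line_vec_cross[k /line_witness[v lj li]] [c _].
move=> /(congr1 (fun f => eval f v)) /eqP.
by rewrite evalZ !eval_linform lj mulr0 (negbTE li).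
Qed.

Lemma ord1_distinct (i j : 'I_1) : i != j -> ~ same_curve (conic0 : mpoly 3 C) conic0.
Proof. by rewrite !ord1 eqxx. Qed.

Definition arrangement : conic_line_arrangement C :=
  @ConicLineArrangement C (size ls) 1 (fun i => linform (line_vec i)) (fun=> conic0)
    ls_gt0 isT is_line_line_vec (fun=> is_smooth_conic0) line_vec_distinct ord1_distinct.

Lemma defining_polynomialE :
  defining_polynomial arrangement = (\prod_i linform (line_vec i)) * conic0.
Proof. by rewrite /defining_polynomial big_sumType /= big_ord1. Qed.

Lemma arrangement_over_rat : defined_over_rat arrangement.
Proof.
have same g : same_curve (C := C) g g by exists 1; rewrite ?oner_neq0 ?scale1r.
case=> [i|_] /=.
  exists (linform (vec rat (L i))).
  suff -> : map_mpoly ratr (linform (vec rat (L i))) = linform (line_vec i) by [].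
  rewrite /linform raddf_sum; apply: eq_bigr => j _ /=.
  by rewrite map_mpolyZ map_mpolyX !mxE rmorph_int.
exists conic0; suff -> : map_mpoly ratr conic0 = conic0 :> mpoly 3 C by [].
by rewrite /conic0 rmorphB rmorphM rmorphXn /= !map_mpolyX.
Qed.

Lemma parallel_point (p : 'rV[C]_3) q t : p != 0 ->
  (forall k, cross (p 0) (vec C q 0) k = 0) -> parallel q t ->
  exists2 c, c != 0 & p = c *: vec C t.
Proof.
move=> p0 pq /and3P[q0 t0 /eqP qt].
have [|c c0 pE] := proportional p0 _ pq; first by rewrite vec_eq0.
have [||k|d d0 qE] := @proportional C (vec C q) (vec C t); rewrite ?vec_eq0 //.
  by rewrite vec_cross qt mxE; case: (val k) => [|[]].
by exists (c * d); rewrite ?mulf_neq0 // -scalerA -qE.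
Qed.

(** A point on two lines is parallel to their cross product, and a point on a line and the conic is
    an end of the chord. This is where incidences over [C] become a finite check on integer
    vectors. *)
Lemma two_components (p : 'rV[C]_3) (i j : 'I_(size ls) + 'I_1) : p != 0 ->
  i != j -> eval (component (A := arrangement) i) p = 0 ->
  eval (component (A := arrangement) j) p = 0 ->
  exists t c, [/\ t \in pts, c != 0 & p = c *: vec C t].
Proof.
have on_conic i' : p != 0 -> eval (linform (line_vec i')) p = 0 -> eval conic0 p = 0 ->
    exists t c, [/\ t \in pts, c != 0 & p = c *: vec C t].
  rewrite eval_linform /line_vec => p0 lp pc.
  case/and5P: conf => _ _ _ _ /and5P[/allP sP _ _ _ _].
  have i's : (i' < size s)%N by rewrite -(size_map chord) -lsE.
  have /sP := mem_nth ((0, 0), (0, 0)) i's.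
  move: lp; rewrite [in nth izero ls]lsE (nth_map ((0, 0), (0, 0))) //.
  case: (nth _ _ _) => -[a1 b1] [a2 b2] lp /andP[/hasP[t1 t1P par1] /hasP[t2 t2P par2]].
  case: (conic_chord p0 pc lp) => [|] /parallel_point par.
    by have [c c0 pE] := par _ p0 par1; exists t1, c.
  by have [c c0 pE] := par _ p0 par2; exists t2, c.
move=> p0; case: i => i; case: j => j //=; last by rewrite !ord1 eqxx.
- move=> ij; have {}ij : i != j by apply: contra_neq ij => ->.
  rewrite !eval_linform => li lj.
  have cross0 a b : dot a p = 0 -> dot b p = 0 ->
      forall k, cross (p 0) (cross (a 0) (b 0)) k = 0.
    move=> ap bp k; rewrite -[LHS]opprK; suff -> :
      - cross (p 0) (cross (a 0) (b 0)) k = cross (cross (a 0) (b 0)) (p 0) k.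
      by rewrite cross_cross ap bp !mulr0 subrr oppr0.
    by rewrite /cross; case: (ord3P k) => -> /=; ring.
  have [_ [t tP par]] := lines_meet ij.
  have vecE a b : vec C (icross a b) 0 = cross (vec C a 0) (vec C b 0).
    by apply/funext => k; rewrite vec_cross.
  by case: par => par; have [|c c0 pE] := parallel_point p0 _ par;
    rewrite ?vecE; [exact: cross0|exists t, c|exact: cross0|exists t, c].
- by move=> _; apply: on_conic.
- by move=> _ pc lp; apply: on_conic lp pc.
Qed.

Lemma component_gradient (i : 'I_(size ls) + 'I_1) p : p != 0 ->
  exists j, eval (partial j (component (A := arrangement) i)) p != 0.
Proof.
move=> p0; case: i => [i|_] /=.
  have /rV0Pn[j lj] := line_vec_neq0 i; exists j.
  by rewrite partial_linform /eval mevalC.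
by have /rV0Pn[j gj] := conic_smooth p0; exists j; rewrite eval_partial_conic0.
Qed.

(** If a single component passed through p, the product rule would give the gradient of f at p as
    that of this component, nonzero by smoothness, times nonzero values. *)
Lemma singular_two_components p :
  singular_point (defining_polynomial arrangement) p -> exists i j,
  [/\ i != j, eval (component (A := arrangement) i) p = 0 &
              eval (component (A := arrangement) j) p = 0].
Proof.
case=> p0; rewrite {1}/defining_polynomial eval_prod => /eqP.
rewrite prodf_seq_eq0 => /hasP[/= i _ /eqP ip] dp; exists i.
apply: contrapT => no_j; have [j dij] := component_gradient i p0.
have := dp j; rewrite /defining_polynomial (bigD1 i) //= /partial mderivM.
rewrite evalD !evalM ip mul0r addr0 => /eqP; rewrite mulf_eq0.
rewrite (negbTE dij) eval_prod prodf_seq_eq0 => /hasP[k _ /andP[ki /eqP kp]].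
by apply: no_j; exists k; rewrite eq_sym.
Qed.

Lemma eval_componentZ c p i : c != 0 ->
  (eval (component (A := arrangement) i) (c *: p) == 0) =
  (eval (component (A := arrangement) i) p == 0).
Proof.
move=> c0; case: i => [i|j] /=.
  by rewrite eval_linformZ mulf_eq0 (negbTE c0).
by rewrite eval_conicZ mulf_eq0 expf_eq0 (negbTE c0).
Qed.

Lemma multiplicityZ c p : c != 0 ->
  multiplicity arrangement (c *: p) = multiplicity arrangement p.
Proof.
by move=> c0; apply: eq_card => i; rewrite !inE eval_componentZ.
Qed.

Lemma multiplicity_vec t : multiplicity arrangement (vec C t) = imult ls t.
Proof.
rewrite /multiplicity -sum1_card big_sumType /imult; congr (_ + _)%N.
  rewrite /through size_filter -sum1_count [RHS](big_nth izero) big_mkord.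
  by apply: eq_bigl => i; rewrite !inE /= eval_linform vec_dot intr_eq0.
rewrite big_mkcond /= big_ord1 !inE /= eval_conic_vec intr_eq0.
by case: eqP.
Qed.

Lemma vec_line_inj t u : t \in pts -> u \in pts ->
  <[vec C t]>%VS = <[vec C u]>%VS -> t = u.
Proof.
move=> tP uP tu; have : vec C t \in <[vec C u]>%VS by rewrite -tu memv_line.
case/vlineP=> c tE; apply: contraPeq isT => neq_tu.
have : pairwise (fun a b => icross a b != izero) pts.
  by case/and5P: conf => _ _ _ _ /and5P[].
move=> /(pairwiseP izero) ptsP.
have cross_tu : icross t u = izero.
  apply/eqP; rewrite -(vec_eq0 C); apply/eqP/rowP => k.
  rewrite -vec_cross tE mxE /cross.
  by case: (ord3P k) => -> /=; rewrite !mxE; ring.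
have := ptsP (index t pts) (index u pts); have := ptsP (index u pts) (index t pts).
rewrite !inE !index_mem !nth_index // (icross_eq0C u) cross_tu eqxx.
move=> /(_ uP tP) ut /(_ tP uP) tu'.
have : index t pts != index u pts.
  apply: contra neq_tu => /eqP eq_index.
  by rewrite -(nth_index izero tP) eq_index nth_index.
by rewrite neq_ltn => /orP[/tu'|/ut].
Qed.

Lemma multiple_pointsE j : multiple_points arrangement j.+2 =
  [set` [seq <[vec C t]>%VS | t <- pts & imult ls t == j.+2]]%classic.
Proof.
apply/seteqP; split=> [W [p [p0 pm] <-]|W /= /mapP[t + ->]]; last first.
  rewrite mem_filter => /andP[/eqP tm tP]; exists (vec C t) => //.
  split; last by rewrite multiplicity_vec.
  rewrite vec_eq0; case/and5P: conf => _ _ _ _ /and5P[_ /allP pts0 _ _ _].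
  exact: pts0.
have /card_gt1P[i1 [i2 [/eqP i1p /eqP i2p i12]]] : (1 < multiplicity arrangement p)%N.
  by rewrite pm.
have [t [c [tP c0 pE]]] := two_components p0 i12 i1p i2p.
have -> : <[p]>%VS = <[vec C t]>%VS.
  apply/eqP; rewrite eqEsubv -!memvE [p in p \in _]pE memvZ ?memv_line //=.
  by rewrite -[vec C t](scalerK c0) -pE memvZ ?memv_line.
apply/mapP; exists t => //; rewrite mem_filter tP andbT.
by rewrite -multiplicity_vec -(multiplicityZ _ c0) -pE pm.
Qed.

Lemma pts_uniq : uniq pts.
Proof.
case/and5P: conf => _ _ _ _ /and5P[_ _ ptsP _ _].
rewrite uniq_pairwise; apply: sub_pairwise ptsP => a b.
by apply: contra_neq => ->; rewrite /icross [b.2 * b.1.2]mulrC [b.1.1 * b.2]mulrC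
  [b.1.2 * b.1.1]mulrC !subrr.
Qed.

Lemma arrangement_weak_combinatorics (w : seq nat) :
  [seq count (fun t => imult ls t == j.+2) pts | j <- iota 0 3] = w ->
  weak_combinatorics arrangement (size ls) 1 w.
Proof.
move=> <-; split=> // j; rewrite multiple_pointsE.
have -> : nth 0%N [seq count (fun t => imult ls t == k.+2) pts | k <- iota 0 3] j =
    size [seq <[vec C t]>%VS | t <- pts & imult ls t == j.+2].
  (* Past the three listed entries [nth] returns 0, which is correct since the configuration bounds
     all multiplicities by 4. *)
  rewrite size_map size_filter; case: j => [|[|[|j]]] //=.
  rewrite nth_nil; apply/esym/eqP; rewrite -leqn0 leqNgt -has_count.
  apply/hasPn => t tP; case/and5P: conf => _ _ _ _ /and5P[_ _ _ /allP ptsm _].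
  by case/andP: (ptsm t tP) => _; apply: contraTneq => ->.
apply: card_eq_seq; rewrite map_inj_in_uniq ?filter_uniq ?pts_uniq //.
move=> t u; rewrite !mem_filter => /andP[_ tP] /andP[_ uP].
exact: vec_line_inj.
Qed.

Lemma conic_transversal t a : t \in pts -> iconic t = 0 -> a \in ls ->
  idot a t = 0 -> icross (igrad t) a != izero.
Proof.
move=> tP t0 als at0; case/and5P: conf => _ _ _ _ /and5P[_ _ _ _ /allP ptsP].
move: (ptsP t tP); rewrite t0 eqxx /= => /allP; apply.
by rewrite mem_filter at0 eqxx.
Qed.

Lemma tangent_line_neq (g h : mpoly 3 C) (p u v : 'rV[C]_3) k :
  (forall j, eval (partial j g) p = u 0 j) ->
  (forall j, eval (partial j h) p = v 0 j) -> cross (u 0) (v 0) k != 0 ->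
  tangent_line g p <> tangent_line h p.
Proof.
move=> gu hv /line_witness[w uw vw] /seteqP[gh _].
have /gh : tangent_line g p w.
  by rewrite /tangent_line /= -[RHS]uw; apply: eq_bigr => j _; rewrite gu.
rewrite /tangent_line /= => hw; case/eqP: vw; rewrite -[RHS]hw.
by apply: eq_bigr => j _; rewrite hv.
Qed.

Lemma arrangement_singularities :
  only_ordinary_quasi_homogeneous_singularities arrangement.
Proof.
move=> p sing; have [p0 _ _] := sing.
have [i [j [ij ip jp]]] := singular_two_components sing.
have [t [c [tP c0 pE]]] := two_components p0 ij ip jp.
have line_t (k : 'I_(size ls)) : dot (line_vec k) p = 0 -> idot (L k) t = 0.
  move=> lp; apply/eqP; rewrite -(intr_eq0 C) -vec_dot; apply/eqP.
  apply: (mulfI c0); rewrite mulr0 -[RHS]lp mulr_sumr pE.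
  by apply: eq_bigr => m _; rewrite [(c *: vec C t) 0 m]mxE mulrCA.
have conic_t : eval conic0 p = 0 -> iconic t = 0.
  rewrite pE eval_conicZ => /eqP; rewrite mulf_eq0 expf_eq0 (negbTE c0) /=.
  by rewrite eval_conic_vec intr_eq0 => /eqP.
have transversal (k : 'I_(size ls)) : dot (line_vec k) p = 0 -> eval conic0 p = 0 ->
    exists m, cross (conic_grad p 0) (line_vec k 0) m != 0.
  move=> /line_t lt /conic_t ct.
  have lk_in := mem_nth izero (ltn_ord k).
  have [m ml] := cross_vec_neq0 C (conic_transversal tP ct lk_in lt).
  exists m; rewrite pE conic_gradZ conic_grad_vec.
  suff -> : cross ((c *: vec C (igrad t)) 0) (line_vec k 0) m =
      c * cross (vec C (igrad t) 0) (line_vec k 0) m by rewrite mulf_neq0.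
  by rewrite /cross; case: (ord3P m) => -> /=; rewrite !mxE; ring.
split.
  have grad_l k m : eval (partial m (linform (line_vec k))) p = line_vec k 0 m.
    by rewrite partial_linform /eval mevalC.
  move=> {ij ip jp}[i1|i1] [i2|i2] //= i12.
  - move=> _ _; have [|k] := @line_vec_cross i1 i2; first by apply: contra_neq i12 => ->.
    by apply: tangent_line_neq => m; apply: grad_l.
  - rewrite eval_linform => lp cp; have [m] := transversal _ lp cp.
    rewrite crossC oppr_eq0; apply: tangent_line_neq => n; first exact: grad_l.
    exact: eval_partial_conic0.
  - rewrite eval_linform => cp lp; have [m] := transversal _ lp cp.
    apply: tangent_line_neq => n; last exact: grad_l.
    exact: eval_partial_conic0.
  - by rewrite !ord1 eqxx in i12.
rewrite defining_polynomialE; have /rV0Pn[m pm] := p0.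
have [cp|cp] := eqVneq (eval conic0 p) 0; last first.
  exact: (quasi_homogeneous_off_conic pm).
(* Of the two distinct components through p at most one is the conic, so there is a line; it also
   serves as the default element below. *)
have [k lk] : exists k, dot (line_vec k) p = 0.
  by case: (i) (j) ij ip jp => [k|i1] [k'|j1] //= => [_|_|_|];
    rewrite ?eval_linform ?ord1 ?eqxx //; [exists k|exists k|exists k'].
pose T := [seq vec C a | a <- through ls t].
have TP k' : dot (line_vec k') p = 0 -> line_vec k' \in T.
  by move=> /line_t lt; apply: map_f; rewrite mem_filter lt eqxx mem_nth.
have Tlines a : a \in T -> exists k', dot (line_vec k') p = 0 /\ a = line_vec k'.
  case/mapP=> a'; rewrite mem_filter => /andP[/eqP at0 /(nthP izero)[n nls a'E]] ->.
  exists (Ordinal nls); rewrite /line_vec /= a'E; split=> //.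
  have /eqP := eval_linformZ (vec C a') c (vec C t).
  by rewrite -pE !eval_linform vec_dot at0 mulr0 => /eqP.
have sizeT : (size T <= 3)%N.
  rewrite size_map; case/and5P: conf => _ _ _ _ /and5P[_ _ _ /allP ptsm _].
  have /andP[_] := ptsm t tP.
  by rewrite /imult (conic_t cp) eqxx addn1.
(* When fewer than three lines pass through p, the default pads the triple (b1, b2, b3) with one of
   them; repetitions are harmless. *)
have Tn n : nth (line_vec k) T n \in T.
  have [nT|Tn] := ltnP n (size T); first exact: mem_nth.
  by rewrite nth_default // TP.
apply: (quasi_homogeneous_on_conic pm (b1 := nth (line_vec k) T 0)
  (b2 := nth (line_vec k) T 1) (b3 := nth (line_vec k) T 2) cp).
  move=> b; rewrite !inE => bT; have /Tlines[k' [lp ->]] : b \in T.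
    by case/or3P: bT => /eqP ->; apply: Tn.
  by split=> //; apply: transversal.
move=> k' /TP k'T; move: (k'T); rewrite -index_mem => idx.
rewrite -(nth_index (line_vec k) k'T) !inE; move: (leq_trans idx sizeT).
by case: (index _ _) => [|[|[|]]] //; rewrite eqxx ?orbT.
Qed.

End Arrangement.

(** * Syzygies of the two arrangements *)

Section ArrangementSyzygies.
Variables (C : numFieldType) (s : seq ((int * int) * (int * int))).
Variables (ls pts : seq ivec).
Hypothesis conf : configuration s ls pts.
Hypothesis ls_gt0 : (0 < size ls)%N.
Local Notation f := (defining_polynomial (arrangement C conf ls_gt0)).
Local Notation lf i := (linform (@line_vec C ls i)).

Lemma line_ndvd_line (i j : 'I_(size ls)) : i != j -> ~ mdvd (lf i) (lf j).
Proof.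
move=> /(line_vec_cross C conf)[k /line_witness[v li lj]].
by move=> /(mdvd_eval (v := v)); rewrite !eval_linform => /(_ li)/eqP; apply/negP.
Qed.

Lemma line_ndvd_conic (i : 'I_(size ls)) : ~ mdvd (lf i) conic0.
Proof.
case/and5P: (conf) => /eqP lsE /allP sP _ _ _.
have i_s : (i < size s)%N by rewrite -(size_map chord) -lsE.
have := sP _ (mem_nth ((0, 0), (0, 0)) i_s).
rewrite /line_vec [in nth izero ls]lsE (nth_map ((0, 0), (0, 0))) //.
case: (nth _ _ _) => -[a1 b1] [a2 b2] /= ab.
(* The sum of the two ends of the chord lies on the line, and the conic takes there the value (a1 b2
   - a2 b1)^2, nonzero since the ends are distinct. *)
pose v := vec C (conic_point (a1, b1)) + vec C (conic_point (a2, b2)).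
move=> /(mdvd_eval (v := v)); rewrite eval_linform eval_conic0 big_ord3 /= !mxE /=.
rewrite !(rmorphXn, rmorphM, rmorphN, rmorphD) /=.
have -> : forall A1 B1 A2 B2 : C, (A1 ^+ 2 + A2 ^+ 2) * (B1 ^+ 2 + B2 ^+ 2) -
   (A1 * B1 + A2 * B2) ^+ 2 = (A1 * B2 - A2 * B1) ^+ 2 by move=> *; ring.
rewrite -!rmorphM -rmorphB /= => h; have /eqP := h ltac:(rewrite !rmorphM /=; ring).
by rewrite expf_eq0 intr_eq0 (negbTE ab).
Qed.

Lemma X_ndvd_conic0 : ~ mdvd (linform (delta_mx 0 i1)) (conic0 : mpoly 3 C).
Proof.
move=> /(mdvd_eval (v := vec C (0, 0, 1))); rewrite -X_linform /eval mevalXU.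
rewrite -/(eval _ _) eval_conic_vec mxE => /(_ erefl)/eqP.
by rewrite intr_eq0.
Qed.

Lemma partial0_conic0 : exists k b, [/\ b != 0,
  partial k (conic0 : mpoly 3 C) = linform b & ~ mdvd (linform b) conic0].
Proof.
exists i0, (delta_mx 0 i1); split; last exact: X_ndvd_conic0.
  by rewrite -linform_eq0 -X_linform mX_neq0.
by rewrite partial_conic0 -X_linform.
Qed.

Lemma arrangement_polynomial : f = conic0 * \prod_i lf i.
Proof. by rewrite defining_polynomialE mulrC. Qed.

Lemma arrangement_polynomialE :
  f = conic0 * \prod_(a <- ls) linform (vec C a).
Proof. by rewrite arrangement_polynomial (big_nth izero) big_mkord. Qed.

Lemma arrangement_polynomial_neq0 : f != 0.
Proof.
rewrite arrangement_polynomial mulf_neq0 //.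
  by have [] := is_smooth_conic0 C.
by apply/prodf_neq0 => i _; rewrite linform_eq0 (line_vec_neq0 C conf).
Qed.

Lemma arrangement_homogeneous : homogeneous (2 + size ls) f.
Proof.
by rewrite arrangement_polynomial; apply: homogeneous_product (homogeneous_conic0 C).
Qed.

Lemma arrangement_gradient_neq0 : exists i, partial i f != 0.
Proof.
apply: contrapT => grad0; have /eqP := euler_homogeneous arrangement_homogeneous.
rewrite big1 => [|i _]; last first.
  have [->|fi] := eqVneq (partial i f) 0; first by rewrite mulr0.
  by case: grad0; exists i.
rewrite eq_sym scaler_eq0 pnatr_eq0 /=.
by rewrite (negbTE arrangement_polynomial_neq0).
Qed.

Lemma arrangement_nearly_free d1 d2 n (kappa : C) (r : 'M[mpoly 3 C]_3) :
  (d1 + d2 = 2 + size ls)%N -> (0 < d1 <= d2)%N -> (n + d1 = d2.+1)%N ->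
  kappa != 0 ->
  (forall i j, homogeneous (if i == i0 then d1 else d2) (r i j)) ->
  (forall j, 'X_i2 ^+ n * r i0 j + 'X_i0 * r i1 j + 'X_i1 * r i2 j = 0) ->
  (forall k, cross (r i0) (r i1) k = mpolyC 3 kappa * 'X_i1 * partial k f) ->
  nearly_free f /\ mdr f = d1.
Proof.
move=> d12 /andP[d1_gt0 d1d2] nd k0 rh rr rc.
have fh := arrangement_homogeneous; rewrite -d12 in fh.
have sat (a b : 'I_3 -> mpoly 3 C) : \sum_i a i * partial i f = 0 ->
    \sum_i b i * partial i f = 0 ->
    exists h, forall k, cross a b k = h * partial k f.
  rewrite arrangement_polynomial; apply: syzygy_cross => //.
  - exact: (line_vec_neq0 C conf).
  - exact: line_ndvd_line.
  - exact: line_ndvd_conic.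
  - exact: homogeneous_conic0.
  - exact: partial0_conic0.
split.
  exact: (nearly_free_resolution arrangement_polynomial_neq0 fh sat
    arrangement_gradient_neq0 d1_gt0 d1d2 nd k0 rh rr rc).
apply: is_mdr_uniq (mdrP fh) _.
exact: (is_mdr_d1 sat arrangement_gradient_neq0 d1d2 k0 rh rr rc).
Qed.

End ArrangementSyzygies.

(** * The two explicit arrangements *)

Section Examples.
Variable C : numFieldType.
Local Notation S := (mpoly 3 C).
Local Notation x := ('X_i0 : S).
Local Notation y := ('X_i1 : S).
Local Notation z := ('X_i2 : S).

Definition row3 (T : Type) (a b c : T) (j : 'I_3) : T :=
  match val j with 0%N => a | 1%N => b | _ => c end.

Lemma linform_vec a :
  linform (vec C a) = a.1.1%:~R * x + a.1.2%:~R * y + a.2%:~R * z.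
Proof.
by rewrite /linform big_ord3 /= !mxE /= -!mul_mpolyC !rmorph_int.
Qed.

Lemma partial_linform_vec a j :
  partial j (linform (vec C a)) = (row3 a.1.1 a.1.2 a.2 j)%:~R.
Proof. by rewrite partial_linform mxE rmorph_int. Qed.

Lemma homogeneous_eq d e (p : S) : homogeneous d p -> d = e -> homogeneous e p.
Proof. by move=> ? <-. Qed.

Lemma homogeneous_nat k : homogeneous 0 (k%:R : S).
Proof. by apply: rpredMn; apply: dhomog1. Qed.

Lemma homogeneous_X i : homogeneous 1 ('X_i : S).
Proof. by rewrite /homogeneous dhomogX /= mdeg1. Qed.

Lemma homogeneousD d (p q : S) :
  homogeneous d p -> homogeneous d q -> homogeneous d (p + q).
Proof. exact: rpredD. Qed.

Lemma homogeneousN d (p : S) : homogeneous d p -> homogeneous d (- p).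
Proof. by move=> hp; rewrite /homogeneous rpredN. Qed.

Lemma homogeneousM d e (p q : S) :
  homogeneous d p -> homogeneous e q -> homogeneous (d + e) (p * q).
Proof. exact: dhomogM. Qed.

Lemma homogeneousXn d (p : S) k : homogeneous d p -> homogeneous (d * k) (p ^+ k).
Proof. exact: dhomogMn. Qed.

(** The degree of a monomial is built up as an existential variable and then compared with the
    expected degree by computation. *)
Ltac monomial_homog := lazymatch goal with
  | |- homogeneous _ (_ * _) => eapply homogeneousM; monomial_homog
  | |- homogeneous _ (_ ^+ _) => eapply homogeneousXn; monomial_homog
  | |- homogeneous _ (- _) => eapply homogeneousN; monomial_homog
  | |- homogeneous _ _%:R => apply homogeneous_nat
  | |- _ => apply homogeneous_X
  end.

Ltac homog := lazymatch goal with
  | |- homogeneous _ (_ + _) => apply homogeneousD; homog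
  | |- homogeneous _ (- _) => apply homogeneousN; homog
  | |- _ => eapply homogeneous_eq; [monomial_homog | reflexivity]
  end.

(* mdr = 3: the lines z = 0, x = 2z, 2x = -z, 2y = z, x = y, 2x - 2y = 3z *)
Definition chords1 : seq ((int * int) * (int * int)) :=
  [:: ((-1, 0), (0, 1)); ((2, 1), (0, 1)); ((-1, 2), (0, 1));
      ((2, 1), (1, 0)); ((1, 1), (-1, 1)); ((2, 1), (-1, 2))].

Definition lines1 : seq ivec :=
  [:: (0, 0, 1); (1, 0, -2); (2, 0, 1); (0, 2, -1); (1, -1, 0); (2, -2, -3)].

Definition points1 : seq ivec := 
  [:: (4, 1, 2); (2, 2, 1); (1, 4, -2); (1, 1, 2); (1, 1, 1); (1, 1, 0);
      (1, 1, -1); (1, 1, -2); (1, 0, 0); (1, -1, -2); (0, 1, 0)].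

(* mdr = 4: in the chart z = 1, the 3 x 3 grid x, y = 1, -2, -1/2 and the
   hyperbola xy = 1 through (1, 1), (-2, -1/2), (-1/2, -2) and the two points
   at infinity of the grid *)
Definition chords2 : seq ((int * int) * (int * int)) :=
  [:: ((1, 1), (0, 1)); ((-2, 1), (0, 1)); ((-1, 2), (0, 1));
      ((1, 1), (1, 0)); ((2, -1), (1, 0)); ((1, -2), (1, 0))].

Definition lines2 : seq ivec :=
  [:: (1, 0, -1); (1, 0, 2); (2, 0, 1); (0, 1, -1); (0, 2, 1); (0, 1, 2)].

(** The incidences behind equal counts differ. Here no component joins the quadruple points (1, 0,
    0) and (0, 1, 0), and all triple points lie on the conic; in the first arrangement the line x =
    2z joins the quadruple points (0, 1, 0) and (4, 1, 2), and the triple point (1, 1, 0) is off the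
    conic. *)
Definition points2 : seq ivec := 
  [:: (4, 1, -2); (2, 2, -1); (2, -1, 2); (2, -1, -1); (1, 4, -2);
      (1, 1, 1); (1, 1, -2); (1, 0, 0); (1, -2, 1); (1, -2, -2); (0, 1, 0)].

Lemma configuration1 : configuration chords1 lines1 points1.
Proof. by vm_compute. Qed.

Lemma configuration2 : configuration chords2 lines2 points2.
Proof. by vm_compute. Qed.

(* The rows r0, r1, r2, found by linear algebra over the rationals, satisfy
   z^n r0 + x r1 + y r2 = 0 and r0 x r1 = kappa y grad f. *)
Definition syzygies1 : 'M[S]_3 := \matrix_(i, j) row3
    (row3
      (-6 * x ^+ 3 + 14 * x ^+ 2 * y + 22 * x ^+ 2 * z - 8 * x * y ^+ 2
       - 28 * x * y * z + 16 * x * z ^+ 2 - 16 * y * z ^+ 2)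
      (10 * x ^+ 2 * y - 18 * x * y ^+ 2 - 26 * x * y * z + 16 * x * z ^+ 2
       + 8 * y ^+ 3 + 20 * y ^+ 2 * z - 16 * y * z ^+ 2)
      (10 * x ^+ 2 * z - 2 * x * y * z - 2 * x * z ^+ 2 - 8 * y ^+ 2 * z
       - 4 * y * z ^+ 2))
    (row3
      (-7 * x ^+ 3 * y ^+ 2 + 4 * x ^+ 3 * y * z + 23 * x ^+ 2 * y ^+ 3
       - 27 * x ^+ 2 * y ^+ 2 * z - 10 * x ^+ 2 * y * z ^+ 2
       + 6 * x ^+ 2 * z ^+ 3 - 4 * x * y ^+ 4 - 6 * x * y ^+ 3 * z
       - 4 * x * y ^+ 2 * z ^+ 2 + 32 * x * y * z ^+ 3 - 22 * x * z ^+ 4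
       - 8 * y ^+ 3 * z ^+ 2 + 16 * y ^+ 2 * z ^+ 3 + 32 * y * z ^+ 4
       - 16 * z ^+ 5)
      (33 * x ^+ 2 * y ^+ 3 - 28 * x ^+ 2 * y ^+ 2 * z - 25 * x * y ^+ 4
       - 3 * x * y ^+ 3 * z - 18 * x * y ^+ 2 * z ^+ 2 + 22 * x * y * z ^+ 3
       + 4 * y ^+ 5 + 2 * y ^+ 4 * z - 4 * y ^+ 3 * z ^+ 2
       + 32 * y ^+ 2 * z ^+ 3 + 10 * y * z ^+ 4 - 16 * z ^+ 5)
      (-31 * x ^+ 2 * y ^+ 2 * z + 4 * x ^+ 2 * y * z ^+ 2
       + 15 * x * y ^+ 3 * z + 25 * x * y ^+ 2 * z ^+ 2 + 22 * x * y * z ^+ 3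
       - 10 * x * z ^+ 4 - 4 * y ^+ 4 * z + 6 * y ^+ 3 * z ^+ 2
       - 4 * y ^+ 2 * z ^+ 3 - 16 * y * z ^+ 4 + 2 * z ^+ 5))
    (row3
      (7 * x ^+ 4 * y - 4 * x ^+ 4 * z - 23 * x ^+ 3 * y ^+ 2
       + 27 * x ^+ 3 * y * z + 10 * x ^+ 3 * z ^+ 2 + 4 * x ^+ 2 * y ^+ 3
       + 6 * x ^+ 2 * y ^+ 2 * z + 4 * x ^+ 2 * y * z ^+ 2
       - 46 * x ^+ 2 * z ^+ 3 + 8 * x * y ^+ 2 * z ^+ 2 - 8 * x * y * z ^+ 3
       - 4 * x * z ^+ 4 + 16 * z ^+ 5)
      (-33 * x ^+ 3 * y ^+ 2 + 28 * x ^+ 3 * y * z + 25 * x ^+ 2 * y ^+ 3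
       + 3 * x ^+ 2 * y ^+ 2 * z + 18 * x ^+ 2 * y * z ^+ 2
       - 32 * x ^+ 2 * z ^+ 3 - 4 * x * y ^+ 4 - 2 * x * y ^+ 3 * z
       + 4 * x * y ^+ 2 * z ^+ 2 - 14 * x * y * z ^+ 3 + 16 * x * z ^+ 4
       - 8 * y ^+ 2 * z ^+ 3 - 20 * y * z ^+ 4 + 16 * z ^+ 5)
      (31 * x ^+ 3 * y * z - 4 * x ^+ 3 * z ^+ 2 - 15 * x ^+ 2 * y ^+ 2 * z
       - 25 * x ^+ 2 * y * z ^+ 2 - 22 * x ^+ 2 * z ^+ 3 + 4 * x * y ^+ 3 * z
       - 6 * x * y ^+ 2 * z ^+ 2 + 4 * x * y * z ^+ 3 + 18 * x * z ^+ 4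
       + 8 * y * z ^+ 4 + 4 * z ^+ 5)) i j.

(** Exchanging x and y preserves the second arrangement. Combined with exchanging the first two
    entries of a row, it fixes r0 and swaps r1 and r2. *)
Definition syzygies2 : 'M[S]_3 := \matrix_(i, j) row3
    (row3
      (-8 * x ^+ 4 + 9 * x ^+ 3 * y - 21 * x ^+ 3 * z - 15 * x ^+ 2 * y ^+ 2
       + 4 * x ^+ 2 * y * z + 21 * x ^+ 2 * z ^+ 2 + 8 * x * y ^+ 3
       + 27 * x * y ^+ 2 * z - 3 * x * y * z ^+ 2 + 16 * x * z ^+ 3
       + 16 * y ^+ 2 * z ^+ 2)
      (8 * x ^+ 3 * y - 15 * x ^+ 2 * y ^+ 2 + 27 * x ^+ 2 * y * z
       + 16 * x ^+ 2 * z ^+ 2 + 9 * x * y ^+ 3 + 4 * x * y ^+ 2 * z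
       - 3 * x * y * z ^+ 2 - 8 * y ^+ 4 - 21 * y ^+ 3 * z
       + 21 * y ^+ 2 * z ^+ 2 + 16 * y * z ^+ 3)
      (8 * x ^+ 3 * z + 16 * x ^+ 2 * y ^+ 2 + 9 * x ^+ 2 * y * z
       + 3 * x ^+ 2 * z ^+ 2 + 9 * x * y ^+ 2 * z + 4 * x * y * z ^+ 2
       - 3 * x * z ^+ 3 + 8 * y ^+ 3 * z + 3 * y ^+ 2 * z ^+ 2
       - 3 * y * z ^+ 3))
    (row3
      (8 * x ^+ 3 * z - 8 * x ^+ 2 * y ^+ 2 - 9 * x ^+ 2 * y * z
       + 21 * x ^+ 2 * z ^+ 2 - 2 * x * y * z ^+ 2 - 21 * x * z ^+ 3
       - 16 * z ^+ 4)
      (-8 * x ^+ 2 * y * z + 8 * x * y ^+ 3 + 15 * x * y ^+ 2 * z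
       - 27 * x * y * z ^+ 2 - 16 * x * z ^+ 3 - 2 * y ^+ 2 * z ^+ 2
       + 3 * y * z ^+ 3)
      (-8 * x ^+ 2 * z ^+ 2 - 8 * x * y ^+ 2 * z - 9 * x * y * z ^+ 2
       - 3 * x * z ^+ 3 - 2 * y * z ^+ 3 + 3 * z ^+ 4))
    (row3
      (8 * x ^+ 3 * y + 15 * x ^+ 2 * y * z - 2 * x ^+ 2 * z ^+ 2
       - 8 * x * y ^+ 2 * z - 27 * x * y * z ^+ 2 + 3 * x * z ^+ 3
       - 16 * y * z ^+ 3)
      (-8 * x ^+ 2 * y ^+ 2 - 9 * x * y ^+ 2 * z - 2 * x * y * z ^+ 2
       + 8 * y ^+ 3 * z + 21 * y ^+ 2 * z ^+ 2 - 21 * y * z ^+ 3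
       - 16 * z ^+ 4)
      (-8 * x ^+ 2 * y * z - 9 * x * y * z ^+ 2 - 2 * x * z ^+ 3
       - 8 * y ^+ 2 * z ^+ 2 - 3 * y * z ^+ 3 + 3 * z ^+ 4)) i j.

Lemma arrangement_nearly_free1 (ls_gt0 : (0 < size lines1)%N) :
  let f := defining_polynomial (arrangement C configuration1 ls_gt0) in
  nearly_free f /\ mdr f = 3.
Proof.
apply: (@arrangement_nearly_free C _ _ _ configuration1 ls_gt0 3 5 3 (-16)
  syzygies1) => // [|i j|j|k].
- by rewrite oppr_eq0 pnatr_eq0.
- rewrite mxE /row3; case: (ord3P i) => ->; case: (ord3P j) => -> /=; homog.
- by rewrite !mxE /row3; case: (ord3P j) => -> /=; ring.
rewrite rmorphN rmorph_nat.
rewrite arrangement_polynomialE !big_cons big_nil mulr1 /partial !mderivM.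
rewrite ![mderiv _ (linform _)]partial_linform_vec ![mderiv _ conic0]partial_conic0.
rewrite !linform_vec /conic0 /cross !mxE /row3.
case: (ord3P k) => -> /=; rewrite ?rmorphN ?rmorph0 ?rmorph1 ?rmorph_nat /=.
- ring.
- ring.
- ring.
Qed.

Lemma arrangement_nearly_free2 (ls_gt0 : (0 < size lines2)%N) :
  let f := defining_polynomial (arrangement C configuration2 ls_gt0) in
  nearly_free f /\ mdr f = 4.
Proof.
apply: (@arrangement_nearly_free C _ _ _ configuration2 ls_gt0 4 4 1 (-8)
  syzygies2) => // [|i j|j|k].
- by rewrite oppr_eq0 pnatr_eq0.
- rewrite mxE /row3; case: (ord3P i) => ->; case: (ord3P j) => -> /=; homog.
- by rewrite !mxE /row3; case: (ord3P j) => -> /=; ring.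
rewrite rmorphN rmorph_nat.
rewrite arrangement_polynomialE !big_cons big_nil mulr1 /partial !mderivM.
rewrite ![mderiv _ (linform _)]partial_linform_vec ![mderiv _ conic0]partial_conic0.
rewrite !linform_vec /conic0 /cross !mxE /row3.
by case: (ord3P k) => -> /=; rewrite ?rmorphN ?rmorph0 ?rmorph1 ?rmorph_nat /=; ring.
Qed.

End Examples.

Local Close Scope ring_scope.

Theorem mainTheorem1 (R : realType) :
  exists CL1 CL2 : conic_line_arrangement R[i],
    [/\ defined_over_rat CL1 /\ defined_over_rat CL2,
        only_ordinary_quasi_homogeneous_singularities CL1 /\
        only_ordinary_quasi_homogeneous_singularities CL2,
        weak_combinatorics CL1 6 1 [:: 6; 3; 2] /\
        weak_combinatorics CL2 6 1 [:: 6; 3; 2],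
        mdr (defining_polynomial CL1) <> mdr (defining_polynomial CL2) &
        nearly_free (defining_polynomial CL1) /\
        nearly_free (defining_polynomial CL2)].
Proof.
have [nf1 mdr1] := @arrangement_nearly_free1 R[i] isT.
have [nf2 mdr2] := @arrangement_nearly_free2 R[i] isT.
exists (arrangement R[i] configuration1 isT), (arrangement R[i] configuration2 isT).
split.
- by split; apply: arrangement_over_rat.
- by split; apply: arrangement_singularities.
- by split; apply: arrangement_weak_combinatorics; vm_compute.
- by rewrite mdr1 mdr2.
- exact: conj nf1 nf2.
Qed.
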